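(* For every positive integer $k$, $\mathsf{NP}\not\subseteq\mathsf{P}\text{-}\mathsf{uniform}~\mathsf{coNSIZE}[n^k]$; that is, there is a language $L\in\mathsf{NP}$ that is not decided by any family $\{C_n\}$ of co-nondeterministic circuits of size $n^k$ for which some polynomial-time Turing machine on input $1^n$ outputs the description of $C_n$.
   Context: A co-nondeterministic circuit $C(x,z)$ (main input $x$, nondeterministic input $z$) computes $C(x)=1$ iff $C(x,z)=1$ for all $z$. $\mathsf{coNSIZE}[s(n)]$ is the class of languages decided by families of co-nondeterministic circuits of size $s(n)$, and $\mathsf{P}\text{-}\mathsf{uniform}~\mathsf{coNSIZE}[s(n)]$ requires in addition that the family be output by a polynomial-time machine on input $1^n$. *)

(* Defs.v *)
From HB Require Import structures.
From mathcomp Require Import all_boot.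

Set Implicit Arguments.
Unset Strict Implicit.
Unset Printing Implicit Defensive.

Definition language := seq bool -> Prop.

(* Every polynomial in n is bounded by [poly_bound c n] for some c. *)
Definition poly_bound (c n : nat) : nat := n ^ c + c.

(** * Deterministic multitape Turing machines *)

(* Tape symbols over the work alphabet G: [None] is the blank, [Some (inl b)]
   a bit, [Some (inr g)] a work symbol. *)
Definition symbol (G : finType) : finType := option (bool + G).

Inductive move := MoveL | MoveR | Stay.

(* A two-way infinite tape. The first list is the part to the left of the head,
   nearest cell first; the second starts with the scanned cell. Every cell
   beyond the two lists is blank. *)
Definition tape (G : finType) : Type := seq (symbol G) * seq (symbol G).

Definition tape_read (G : finType) (t : tape G) : symbol G := head None t.2.

Definition tape_write (G : finType) (s : symbol G) (t : tape G) : tape G :=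
  (t.1, s :: behead t.2).

Definition tape_move (G : finType) (m : move) (t : tape G) : tape G :=
  match m with
  | MoveL => (behead t.1, head None t.1 :: t.2)
  | MoveR => (head None t.2 :: t.1, behead t.2)
  | Stay => t
  end.

(* The machine has [(tm_tapes M).+1] tapes; the transition function maps the
   state and the scanned symbols to a new state and, on each tape, a symbol to
   write and a move. *)
Record tm := TM {
  tm_tapes : nat;
  tm_state : finType;
  tm_work : finType;
  tm_start : tm_state;
  tm_halt : pred tm_state;
  tm_trans : tm_state -> {ffun 'I_tm_tapes.+1 -> symbol tm_work} ->
             tm_state * {ffun 'I_tm_tapes.+1 -> symbol tm_work * move}
}.

Record config (M : tm) := Config {
  cf_state : tm_state M;
  cf_tape : {ffun 'I_(tm_tapes M).+1 -> tape (tm_work M)}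
}.

Definition tm_step (M : tm) (c : config M) : config M :=
  if tm_halt (cf_state c) then c else
  let: (q, act) :=
    tm_trans (cf_state c) [ffun i => tape_read (cf_tape c i)] in
  Config q [ffun i => tape_move (act i).2 (tape_write (act i).1 (cf_tape c i))].

(* The input is on the first tape, with the head on its first bit; the other
   tapes are blank. *)
Definition tm_init (M : tm) (w : seq bool) : config M :=
  Config (tm_start M)
    [ffun i => if i == ord0
               then ([::], [seq Some (inl b) : symbol (tm_work M) | b <- w])
               else ([::], [::])].

Fixpoint leading_bits (G : finType) (s : seq (symbol G)) : seq bool :=
  if s is Some (inl b) :: s' then b :: leading_bits s' else [::].

(* The output is the maximal block of bits on the last tape that starts at the
   head. *)
Definition tm_output (M : tm) (c : config M) : seq bool :=
  leading_bits (cf_tape c ord_max).2.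

(* On input w, M halts within t steps with output v. (Halting configurations
   are fixed by [tm_step].) *)
Definition tm_computes_in (M : tm) (w : seq bool) (t : nat) (v : seq bool) :
    Prop :=
  let c := iter t (@tm_step M) (tm_init M w) in
  tm_halt (cf_state c) /\ tm_output c = v.

(** * P and NP *)

Definition poly_decidable (R : pred (seq bool)) : Prop :=
  exists (M : tm) (c : nat), forall w : seq bool,
    tm_computes_in M w (poly_bound c (size w)) [:: R w].

(* Each bit of x is doubled, and 01 separates x from y. *)
Definition pair_code (x y : seq bool) : seq bool :=
  flatten [seq [:: b; b] | b <- x] ++ [:: false; true] ++ y.

Definition NP (L : language) : Prop :=
  exists (R : pred (seq bool)) (c : nat),
    poly_decidable R /\
    forall x : seq bool,
      L x <-> exists y : seq bool,
                size y <= poly_bound c (size x) /\ R (pair_code x y).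

(** * Co-nondeterministic circuits *)

(* A wire carries a bit of the main input, a bit of the nondeterministic input,
   or the value of an earlier gate. *)
Inductive wire := Main of nat | Aux of nat | Gate of nat.

Inductive gate := Not of wire | And of wire & wire | Or of wire & wire.

Record circuit := Circuit {
  c_aux : nat;  (* length of the nondeterministic input *)
  c_gates : seq gate;
  c_out : wire
}.

Definition wire_ok (n m t : nat) (w : wire) : bool :=
  match w with
  | Main i => i < n
  | Aux j => j < m
  | Gate g => g < t
  end.

Definition gate_ok (n m t : nat) (g : gate) : bool :=
  match g with
  | Not u => wire_ok n m t u
  | And u v | Or u v => wire_ok n m t u && wire_ok n m t v
  end.

(* [t] is the index of the first gate of the list. *)
Fixpoint gates_ok (n m t : nat) (gs : seq gate) : bool :=
  if gs is g :: gs' then gate_ok n m t g && gates_ok n m t.+1 gs' else true.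

Definition circuit_ok (n : nat) (C : circuit) : bool :=
  gates_ok n (c_aux C) 0 (c_gates C) &&
  wire_ok n (c_aux C) (size (c_gates C)) (c_out C).

(* The number of gates; inputs, main or nondeterministic, are not counted. *)
Definition circuit_size (C : circuit) : nat := size (c_gates C).

(* [vs] lists the values of the gates already evaluated. The default value of
   [nth] is never used when [circuit_ok] holds. *)
Definition wire_val (x z vs : seq bool) (w : wire) : bool :=
  match w with
  | Main i => nth false x i
  | Aux j => nth false z j
  | Gate g => nth false vs g
  end.

Definition gate_val (x z vs : seq bool) (g : gate) : bool :=
  match g with
  | Not u => ~~ wire_val x z vs u
  | And u v => wire_val x z vs u && wire_val x z vs v
  | Or u v => wire_val x z vs u || wire_val x z vs v
  end.

Definition gate_vals (x z : seq bool) (gs : seq gate) : seq bool :=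
  foldl (fun vs g => rcons vs (gate_val x z vs g)) [::] gs.

Definition circuit_eval (C : circuit) (x z : seq bool) : bool :=
  wire_val x z (gate_vals x z (c_gates C)) (c_out C).

Definition co_accepts (C : circuit) (x : seq bool) : Prop :=
  forall z : (c_aux C).-tuple bool, circuit_eval C x z.

Definition co_decides (C : nat -> circuit) (L : language) : Prop :=
  forall x : seq bool, L x <-> co_accepts (C (size x)) x.

(** * Descriptions of circuits *)

(* Unary, so that the length of the nondeterministic input and the length of
   a description are polynomially related. *)
Definition nat_code (i : nat) : seq bool := nseq i true ++ [:: false].

Definition wire_code (w : wire) : seq bool :=
  match w with
  | Main i => [:: false; false] ++ nat_code i
  | Aux j => [:: false; true] ++ nat_code j
  | Gate g => [:: true; false] ++ nat_code g
  end.

Definition gate_code (g : gate) : seq bool :=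
  match g with
  | Not u => [:: false; false] ++ wire_code u
  | And u v => [:: true; false] ++ wire_code u ++ wire_code v
  | Or u v => [:: true; true] ++ wire_code u ++ wire_code v
  end.

(* A gate is preceded by 1, and the list of gates ends with 0. *)
Definition circuit_code (C : circuit) : seq bool :=
  nat_code (c_aux C) ++
  flatten [seq true :: gate_code g | g <- c_gates C] ++
  false :: wire_code (c_out C).

Definition P_uniform (C : nat -> circuit) : Prop :=
  exists (M : tm) (c : nat), forall n : nat,
    tm_computes_in M (nseq n true) (poly_bound c n) (circuit_code (C n)).

(** * Circuit classes *)

(* The size bound is asymptotic. Imposed at every length, it would exclude some
   finite languages: it suffices that at one length n a function on n bits
   needs more than [s n] gates. *)
Definition coNSIZE_family (s : nat -> nat) (C : nat -> circuit)
    (L : language) : Prop :=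
  [/\ forall n, circuit_ok n (C n),
      exists n0, forall n, n0 <= n -> circuit_size (C n) <= s n
    & co_decides C L].

Definition coNSIZE (s : nat -> nat) (L : language) : Prop :=
  exists C : nat -> circuit, coNSIZE_family s C L.

Definition P_uniform_coNSIZE (s : nat -> nat) (L : language) : Prop :=
  exists C : nat -> circuit, coNSIZE_family s C L /\ P_uniform C.

(* Main.v *)
(** The rejection of an input by a co-nondeterministic circuit is a constraint
    satisfaction problem whose variables are the wire occurrences, so that its
    size depends on the number of gates only. The hard language L accepts x if
    there is an assignment extending the bits of x that satisfies the
    constraints described by a second such problem, whose constraints are listed
    in x itself.

    Suppose that a P-uniform family (C_n) of co-nondeterministic circuits of size
    n^k decides L. The violated constraints of C_n, with the positions written on
    about n^(1/(3k+1)) bits, form an NP language, for a nondeterministic machine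
    can guess and check the computation that outputs C_n. If this language had
    co-nondeterministic circuits of size m^k too, the constraints of the circuit
    D for queries about C_n would fit in an input x of length n. For that x, a
    query is satisfied by C_n if and only if D rejects it, hence x is in L if and
    only if C_n rejects x.

    Membership in NP comes from bounded first-order definability: the formulas
    are evaluated by counter programs, and a counter is the position of a head
    on a tape that is never written. *)

From HB Require Import structures.
Require Import Defs.
From mathcomp Require Import all_boot zify.
From Stdlib Require Import FunctionalExtensionality ClassicalEpsilon.

Set Implicit Arguments.
Unset Strict Implicit.
Unset Printing Implicit Defensive.

(** * Counter programs *)

(** Direct diagonalization fails because the exponent of the running time that produces [C n] is
    unbounded, while the hard language has to be fixed in advance. The second circuit removes this
    dependence: [D] answers queries about [C n], but its size is [q ^ k] for queries of length q,
    whatever that running time is. Queries must therefore be much shorter than n, which is why n is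
    a power [b ^ len_exp k] and q is linear in b: the constraint table of [D] has about b^(3k) bits,
    below n = b^(3k+1), and a time polynomial in n is still polynomial in b. [D] also supplies a
    negation. That a constraint of [C n] is not violated is the complement of an NP property;
    rejection by a co-nondeterministic circuit is existential, so it can be certified in the witness
    for x. The language is chosen by excluded middle: either [hard_language k c] is already outside
    the class, or a uniform family deciding it defines a violation language, which is then
    outside. *)

Definition store := nat -> nat.

Definition upd (s : store) (i v : nat) : store :=
  fun j => if j == i then v else s j.

Notation sym := (symbol unit).

Definition mark : sym := Some (inr tt).

(* Register 0 is the head position on the input tape. Every other register is
   the head position on a tape that is blank except for a mark at position 0:
   a counter is never written, only moved. *)
Definition tape_sym (w : seq bool) (i h : nat) : sym :=
  if i == 0 then nth None [seq Some (inl b) | b <- w] h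
  else if h == 0 then mark else None.

Inductive cmd :=
| Skip
| Inc of nat
| Dec of nat
| Seq of cmd & cmd
| If of nat & pred sym & cmd & cmd
| While of nat & pred sym & cmd.

(** The last argument is the number of steps of the compiled code, jumps included. A decrement at 0
    is truncated on a counter, where the machine sees the mark and stays; the left end of the input
    is not marked, so register 0 must be positive. *)
Inductive exec (w : seq bool) : cmd -> store -> store -> nat -> Prop :=
| ESkip s : exec w Skip s s 0
| EInc i s : exec w (Inc i) s (upd s i (s i).+1) 1
| EDec i s : (0 < i) || (0 < s i) -> exec w (Dec i) s (upd s i (s i).-1) 1
| ESeq p q s s1 s2 t1 t2 :
    exec w p s s1 t1 -> exec w q s1 s2 t2 -> exec w (Seq p q) s s2 (t1 + t2)
| EIfT i (T : pred sym) p q s s1 t :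
    T (tape_sym w i (s i)) -> exec w p s s1 t -> exec w (If i T p q) s s1 t.+2
| EIfF i (T : pred sym) p q s s1 t :
    ~~ T (tape_sym w i (s i)) -> exec w q s s1 t ->
    exec w (If i T p q) s s1 t.+1
| EWhileF i (T : pred sym) p s :
    ~~ T (tape_sym w i (s i)) -> exec w (While i T p) s s 1
| EWhileT i (T : pred sym) p s s1 s2 t1 t2 :
    T (tape_sym w i (s i)) -> exec w p s s1 t1 ->
    exec w (While i T p) s1 s2 t2 -> exec w (While i T p) s s2 (t1 + t2).+2.

(** * Compilation to Turing machines *)

Inductive instr :=
| IInc of nat
| IDec of nat
| IBranch of nat & pred sym & nat  (* jump if the test fails *)
| IJump of nat.

Definition instr_reg (I : instr) : nat :=
  match I with
  | IInc i => i
  | IDec i => i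
  | IBranch i _ _ => i
  | IJump _ => 0
  end.

(** Jumps are absolute, so the code depends on the address [b] where it is placed. *)
Fixpoint comp (b : nat) (p : cmd) : seq instr :=
  match p with
  | Skip => [::]
  | Inc i => [:: IInc i]
  | Dec i => [:: IDec i]
  | Seq p q => let c := comp b p in c ++ comp (b + size c) q
  | If i T p q =>
      let c := comp b.+1 p in
      let c' := comp (b + size c).+2 q in
      IBranch i T (b + size c).+2 :: c ++
        IJump ((b + size c).+2 + size c') :: c'
  | While i T p =>
      let c := comp b.+1 p in
      IBranch i T (b + size c).+2 :: rcons c (IJump b)
  end.

Definition code_at (code : seq instr) (b : nat) (l : seq instr) : Prop :=
  exists c1 c3, code = c1 ++ l ++ c3 /\ size c1 = b.

Lemma code_at_cat code b l1 l2 :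
  code_at code b (l1 ++ l2) ->
  code_at code b l1 /\ code_at code (b + size l1) l2.
Proof.
case=> c1 [c3 [-> <-]]; split; first by exists c1, (l2 ++ c3); rewrite !catA.
by exists (c1 ++ l1), c3; rewrite size_cat !catA.
Qed.

Lemma code_at_cons code b I l :
  code_at code b (I :: l) ->
  [/\ b < size code, nth (IJump 0) code b = I & code_at code b.+1 l].
Proof.
case=> c1 [c3 [-> <-]]; rewrite size_cat nth_cat ltnn subnn /=; split=> //.
  by lia.
by exists (rcons c1 I), c3; rewrite -cats1 -catA size_cat addn1.
Qed.

Section Machine.

Variables (code : seq instr) (res K : nat).

Notation mstate := (option (bool + 'I_(size code).+1)).

Definition goto (l : nat) : mstate := Some (inr (inord l)).

(** State [None] writes the marks in one step, [Some (inr l)] is the program counter, and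
    [Some (inl b)] halts with verdict b. The verdict is read off register [res] once the counter has
    run past the code. *)
Definition code_trans (q : mstate) (a : {ffun 'I_K.+1 -> sym}) :
    mstate * {ffun 'I_K.+1 -> sym * move} :=
  let act (i : nat) (m : move) : {ffun 'I_K.+1 -> sym * move} :=
    [ffun j : 'I_K.+1 => (a j, if (j : nat) == i then m else Stay)] in
  match q with
  | None =>
      (goto 0, [ffun j : 'I_K.+1 => (if j == ord0 then a j else mark, Stay)])
  | Some (inl _) => (q, act 0 Stay)
  | Some (inr l) =>
      if l < size code then
        match nth (IJump 0) code l with
        | IInc i => (goto l.+1, act i MoveR)
        | IDec i =>
            (goto l.+1, act i (if a (inord i) == mark then Stay else MoveL))
        | IBranch i T l' =>
            (goto (if T (a (inord i)) then l.+1 else l'), act 0 Stay)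
        | IJump l' => (goto l', act 0 Stay)
        end
      else
        let b := a (inord res) != mark in
        (Some (inl b),
         [ffun j : 'I_K.+1 =>
           (if j == ord_max then Some (inl b) else a j, Stay)])
  end.

Definition code_tm : tm :=
  @TM K mstate unit None
    (fun q => if q is Some (inl _) then true else false) code_trans.

End Machine.

(** Lists that differ by trailing blanks represent the same tape, so a tape is compared with a
    function on cells, through [nth] with the blank as default. *)
Definition tape_at (cell : nat -> sym) (h : nat) (t : tape unit) : Prop :=
  (forall p, nth None t.2 p = cell (h + p)) /\
  (forall p, p < h -> nth None t.1 p = cell (h - p.+1)).

Lemma tape_at_read cell h t : tape_at cell h t -> tape_read t = cell h.
Proof. by case=> H _; rewrite /tape_read -nth0 H addn0. Qed.

Lemma nth_write (t : tape unit) p :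
  nth None (tape_read t :: behead t.2) p = nth None t.2 p.
Proof. by case: t => l [|x r] /=; case: p => //= p; rewrite nth_nil. Qed.

Lemma tape_at_stay cell h t : tape_at cell h t ->
  tape_at cell h (tape_move Stay (tape_write (tape_read t) t)).
Proof. by case=> H1 H2; split=> // p; rewrite nth_write. Qed.

Lemma tape_at_right cell h t : tape_at cell h t ->
  tape_at cell h.+1 (tape_move MoveR (tape_write (tape_read t) t)).
Proof.
case=> H1 H2; split=> [p|[|p]] /=.
- by rewrite addSnnS -H1; case: (t.2) => //=; rewrite nth_nil.
- by move=> _; rewrite /tape_read -nth0 H1; congr cell; lia.
- by move=> hp; rewrite H2 //; congr cell; lia.
Qed.

Lemma tape_at_left cell h t : tape_at cell h.+1 t ->
  tape_at cell h (tape_move MoveL (tape_write (tape_read t) t)).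
Proof.
case=> H1 H2; split=> [[|p]|p hp].
- by rewrite /= -nth0 H2 //; congr cell; lia.
- by rewrite /= nth_write H1; congr cell; lia.
- by rewrite /= nth_behead H2 //; congr cell; lia.
Qed.

Section Simulation.

Variables (code : seq instr) (res K : nat) (w : seq bool).
Hypothesis codeK : all (fun I => instr_reg I <= K) code.

Notation M := (code_tm code res K).

Definition sim (c : config M) (b : nat) (s : store) : Prop :=
  cf_state c = goto code b /\
  forall j : 'I_K.+1, tape_at (tape_sym w j) (s j) (cf_tape c j).

Lemma sim_read c b s i : sim c b s -> i <= K ->
  tape_read (cf_tape c (inord i)) = tape_sym w i (s i).
Proof. by move=> [_ H] hi; rewrite (tape_at_read (H _)) inordK. Qed.

Lemma instrK b : b < size code -> instr_reg (nth (IJump 0) code b) <= K.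
Proof. by move=> hb; apply: (all_nthP (IJump 0) codeK). Qed.

Lemma sim_step c b s I : sim c b s -> b < size code ->
    nth (IJump 0) code b = I ->
  match I with
  | IInc i => sim (tm_step c) b.+1 (upd s i (s i).+1)
  | IDec i =>
      (0 < i) || (0 < s i) -> sim (tm_step c) b.+1 (upd s i (s i).-1)
  | IBranch i T l =>
      sim (tm_step c) (if T (tape_sym w i (s i)) then b.+1 else l) s
  | IJump l => sim (tm_step c) l s
  end.
Proof.
move=> simc hb defI; have hI := instrK hb; rewrite defI in hI.
have [hc ht] := simc.
have hb1 : b < (size code).+1 by rewrite ltnS ltnW.
rewrite /tm_step hc /= (inordK hb1) hb defI.
case: I defI hI => [i|i|i T l|l] _ /= hi.
- split=> //= j; rewrite !ffunE /= ?ffunE /upd.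
  case: eqP => [<-|_]; first exact: tape_at_right.
  exact: tape_at_stay.
- rewrite ffunE (sim_read simc) // => h0; split=> //= j.
  rewrite !ffunE /= ?ffunE /upd; case: eqP => [ji|_]; last exact: tape_at_stay.
  have := ht j; rewrite ji; case si: (s i) h0 => [|h] /= h0 hj.
    have i0 : (i == 0) = false by lia.
    have -> : tape_sym w i 0 == mark by rewrite /tape_sym i0.
    exact: tape_at_stay.
  (* A counter tape is blank at h + 1, and the input tape holds only bits and blanks, so the head
     does move. *)
  have -> : (tape_sym w i h.+1 == mark) = false; last exact: tape_at_left.
  rewrite /tape_sym; case: (i == 0) => //.
  have [hh|hh] := ltnP h.+1 (size w); first by rewrite (nth_map false).
  by rewrite nth_default // size_map.
- rewrite ffunE (sim_read simc) //; split=> //= j; rewrite !ffunE /= ?ffunE.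
  by case: ifP => _; exact: tape_at_stay.
- split=> //= j; rewrite !ffunE /= ?ffunE.
  by case: ifP => _; exact: tape_at_stay.
Qed.

Lemma sim_exec p s s' t : exec w p s s' t ->
  forall b c, code_at code b (comp b p) -> sim c b s ->
  sim (iter t (@tm_step M) c) (b + size (comp b p)) s'.
Proof.
have simE (c : config M) b b' st : b = b' -> sim c b st -> sim c b' st.
  by move=> ->.
have iterC n (c : config M) : tm_step (iter n (@tm_step M) c) =
  iter n (@tm_step M) (tm_step c) by rewrite -iterSr.
elim=> {p s s' t}
  [s|i s|i s h0|p q s s1 s2 t1 t2 _ IHp _ IHq|i T p q s s1 t hT _ IH
  |i T p q s s1 t hT _ IH|i T p s hT|i T p s s1 s2 t1 t2 hT _ IHp _ IHw] b c.
- by rewrite addn0.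
- by rewrite addn1 => /code_at_cons [hb hI _] hs; exact: (sim_step hs hb hI).
- by rewrite addn1 => /code_at_cons [hb hI _] hs; exact: (sim_step hs hb hI).
- rewrite /= => /code_at_cat[hp hq] hs; rewrite addnC iterD size_cat addnA.
  by apply: IHq => //; apply: IHp.
- rewrite /= => /code_at_cons[hb hI /code_at_cat[hp]].
  move=> /code_at_cons[hb' hI' _] hs.
  have := sim_step hs hb hI; rewrite hT => /(IH _ _ hp).
  set c1 := iter t _ _ => hs1.
  rewrite iterC -/c1.
  move: (sim_step hs1 hb' hI'); apply: simE.
  by rewrite size_cat /=; lia.
- rewrite /= => /code_at_cons[hb hI /code_at_cat[hp]].
  move=> /code_at_cons[hb' hI' hq] hs.
  have := sim_step hs hb hI; rewrite (negbTE hT) => hs1.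
  have := IH _ _ hq; rewrite addSn => /(_ _ hs1).
  by rewrite -iterC; apply: simE; rewrite size_cat /=; lia.
- rewrite /= => /code_at_cons[hb hI _] hs.
  have := sim_step hs hb hI; rewrite (negbTE hT).
  by apply: simE; rewrite size_rcons; lia.
- move=> hcode hs; move: (hcode); rewrite /= -cats1.
  move=> /code_at_cons[hb hI /code_at_cat[hp]].
  move=> /code_at_cons[hb' hI' _].
  have := sim_step hs hb hI; rewrite hT => /(IHp _ _ hp) hs1.
  have hs2 := sim_step hs1 hb' hI'.
  rewrite iterC in hs2; rewrite /= !iterC addnC iterD.
  by have := IHw _ _ hcode hs2; rewrite /= cats1.
Qed.

End Simulation.

(** For n below 2 the base is at most 3 and the additive constant suffices; for n at least 2, n + 2
    is at most n^2, which doubles the exponent. *)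
Lemma poly_bound_pow a b :
  exists c, forall n, n.+2 ^ a + b <= poly_bound c n.
Proof.
exists (3 ^ a + a.*2 + b) => n; rewrite /poly_bound.
have [n2|n2] := ltnP n 2.
  have : n.+2 ^ a <= 3 ^ a by case: (posnP a) => [->|a0] //; rewrite leq_exp2r.
  by lia.
have : n.+2 ^ a <= n ^ a.*2.
  rewrite -muln2 mulnC expnM; case: (posnP a) => [->|a0] //.
  by rewrite leq_exp2r //; nia.
have : n ^ a.*2 <= n ^ (3 ^ a + a.*2 + b) by rewrite leq_pexp2l //; lia.
by lia.
Qed.

Lemma code_at_self l : code_at l 0 l.
Proof. by exists [::], [::]; rewrite cats0. Qed.

Theorem exec_poly_decidable (R : pred (seq bool)) p r a :
  0 < r ->
  (forall w, exists s t,
     [/\ exec w p (fun=> 0) s t, t <= (size w).+2 ^ a & (0 < s r) = R w]) ->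
  poly_decidable R.
Proof.
move=> r0 hp; pose code := comp 0 p.
pose K := r + \max_(I <- code) (instr_reg I).
have codeK : all (fun I => instr_reg I <= K) code.
  rewrite /K; elim: (code) => //= I l IH; rewrite big_cons.
  apply/andP; split; first by lia.
  by apply: sub_all IH => J; lia.
(* The two additional steps write the marks at the beginning and the verdict at the end. *)
have [c hc] := poly_bound_pow a 2; exists (code_tm code r K), c => w.
have [s [t [he ht hr]]] := hp w; set M := code_tm _ _ _.
have sim0 : sim w (tm_step (tm_init M w)) 0 (fun=> 0).
  rewrite /tm_step /=; split=> //= j; rewrite !ffunE /=.
  have [->|j0] := eqVneq j ord0; split=> q //=; rewrite ?add0n.
  - by rewrite nth_write.
  - rewrite /tape_sym (negbTE (j0 : (j : nat) != 0)); case: q => //= q.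
    by rewrite nth_nil.
have sim1 := sim_exec codeK he (code_at_self code) sim0.
have hfin : exists c1 : config M,
    iter t.+2 (@tm_step M) (tm_init M w) = c1 /\
    tm_halt (cf_state c1) /\ tm_output c1 = [:: R w].
  eexists; split; first by reflexivity.
  rewrite iterS iterSr; set c1 := iter t _ _ in sim1 *.
  have rK : r <= K by rewrite /K; lia.
  have [hq htp] := sim1.
  rewrite /tm_step hq /= inordK // ltnn /= ffunE (sim_read sim1) //.
  split=> //; rewrite /tm_output /= !ffunE /= eqxx /=.
  have [h1 _] := htp ord_max.
  (* The cell to the right of the verdict is at a positive position of a counter tape, hence blank:
     the output is a single bit. *)
  have := h1 1; rewrite /tape_sym /= -[K == 0](_ : false = _); last by lia.
  rewrite addn1 /= => h2; congr (_ :: _).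
    by rewrite -hr /tape_sym; case: (r) (r0) => //= r' _; case: (s _).
  by case: (cf_tape c1 ord_max).2 h2 => [|x [|[y|] l]].
have {hfin} [c1 [hc1 [hh ho]]] := hfin.
rewrite /tm_computes_in.
have ht2 : t.+2 <= poly_bound c (size w) by have := hc (size w); lia.
rewrite -(subnK ht2) iterD hc1.
suff -> n : iter n (@tm_step M) c1 = c1 by [].
by elim: n => //= n ->; rewrite /tm_step hh.
Qed.

(** * Polynomially bounded functions *)

(** The base n + 2 is at least 2 for every n, so that powers absorb constants without exceptions at
    small n. *)
Definition pbounded (f : nat -> nat) : Prop :=
  exists a, forall n, f n <= n.+2 ^ a.

Lemma pbounded_le f g : (forall n, f n <= g n) -> pbounded g -> pbounded f.
Proof. by move=> fg [a ha]; exists a => n; apply: leq_trans (ha n). Qed.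

Lemma pbounded_cst k : pbounded (fun=> k).
Proof.
exists k => n; apply: leq_trans (leq_trans (ltnW (ltn_expl k (ltnSn 1))) _).
  by [].
by case: k => // k; rewrite leq_exp2r.
Qed.

Lemma pbounded_id : pbounded id.
Proof. by exists 1 => n; rewrite expn1 /=; lia. Qed.

Lemma pbounded_mul f g :
  pbounded f -> pbounded g -> pbounded (fun n => f n * g n).
Proof. by move=> [a ha] [b hb]; exists (a + b) => n; rewrite expnD leq_mul. Qed.

Lemma pbounded_add f g :
  pbounded f -> pbounded g -> pbounded (fun n => f n + g n).
Proof.
move=> [a ha] [b hb]; exists (a + b).+1 => n.
have ha1 : 0 < n.+2 ^ a by rewrite expn_gt0.
have hb1 : 0 < n.+2 ^ b by rewrite expn_gt0.
have := leq_pmulr (n.+2 ^ a) hb1; have := leq_pmull (n.+2 ^ b) ha1.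
have := ha n; have := hb n; rewrite expnS expnD.
move: (n.+2 ^ a) (n.+2 ^ b) => A B; move: (A * B) => AB.
by rewrite !mulSn; move: (n * AB) => C; lia.
Qed.

Lemma pbounded_comp f g :
  pbounded f -> pbounded g -> pbounded (fun n => f (g n)).
Proof.
move=> [a ha] [b hb]; exists (b.+2 * a) => n; apply: leq_trans (ha _) _.
rewrite expnM; case: (posnP a) => [->|a0] //; rewrite leq_exp2r //.
have := hb n; have : 0 < n.+2 ^ b by rewrite expn_gt0.
by rewrite !expnS; move: (n.+2 ^ b) => B; nia.
Qed.

Lemma pbounded_exp f a : pbounded f -> pbounded (fun n => f n ^ a).
Proof.
move=> hf; elim: a => [|a IH]; first exact: pbounded_cst.
by apply: pbounded_le (pbounded_mul hf IH) => n; rewrite expnS.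
Qed.

(** * Bounded first-order formulas over strings *)

(* A variable is a de Bruijn level: it denotes an entry of the list of values
   of the variables bound so far, outermost first. *)
Inductive term :=
| TVar of nat
| TCst of nat
| TAdd of term & term
| TMul of term & term.

Inductive form :=
| FBit of term
| FLt of term & term
| FEq of term & term
| FNot of form
| FAnd of form & form
| FOr of form & form
| FImp of form & form
| FAll of term & form
| FEx of term & form.

Fixpoint teval (e : seq nat) (t : term) : nat :=
  match t with
  | TVar l => nth 0 e l
  | TCst n => n
  | TAdd t1 t2 => teval e t1 + teval e t2
  | TMul t1 t2 => teval e t1 * teval e t2
  end.

Fixpoint fval (w : seq bool) (e : seq nat) (f : form) : bool :=
  match f with
  | FBit t => nth false w (teval e t)
  | FLt t1 t2 => teval e t1 < teval e t2
  | FEq t1 t2 => teval e t1 == teval e t2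
  | FNot f1 => ~~ fval w e f1
  | FAnd f1 f2 => fval w e f1 && fval w e f2
  | FOr f1 f2 => fval w e f1 || fval w e f2
  | FImp f1 f2 => fval w e f1 ==> fval w e f2
  | FAll t f1 => all (fun i => fval w (rcons e i) f1) (iota 0 (teval e t))
  | FEx t f1 => has (fun i => fval w (rcons e i) f1) (iota 0 (teval e t))
  end.

Fixpoint fsat (w : seq bool) (e : seq nat) (f : form) : Prop :=
  match f with
  | FBit t => nth false w (teval e t)
  | FLt t1 t2 => teval e t1 < teval e t2
  | FEq t1 t2 => teval e t1 = teval e t2
  | FNot f1 => ~ fsat w e f1
  | FAnd f1 f2 => fsat w e f1 /\ fsat w e f2
  | FOr f1 f2 => fsat w e f1 \/ fsat w e f2
  | FImp f1 f2 => fsat w e f1 -> fsat w e f2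
  | FAll t f1 => forall i, i < teval e t -> fsat w (rcons e i) f1
  | FEx t f1 => exists i, i < teval e t /\ fsat w (rcons e i) f1
  end.

Lemma fsatP w e f : reflect (fsat w e f) (fval w e f).
Proof.
elim: f e => [t|t1 t2|t1 t2|f1 IH|f1 IH1 f2 IH2|f1 IH1 f2 IH2|f1 IH1 f2 IH2
  |t f1 IH|t f1 IH] e /=.
- exact: idP.
- exact: idP.
- exact: eqP.
- by apply: (iffP idP) => [/negP H /IH|H]; [|apply/negP => /IH].
- by apply: (iffP andP) => -[/IH1 ? /IH2].
- by apply: (iffP orP) => -[/IH1|/IH2]; auto.
- by apply: (iffP implyP) => H /IH1 /H /IH2.
- apply: (iffP allP) => H i; last by rewrite mem_iota add0n => /H /IH.
  by move=> hi; apply/IH/H; rewrite mem_iota.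
- apply: (iffP hasP) => [[i]|[i [hi /IH h]]]; last by exists i => //; rewrite mem_iota.
  by rewrite mem_iota add0n => hi /IH h; exists i.
Qed.

(** * Evaluation of formulas by counter programs *)

Definition nonzero : pred sym := fun x => x != mark.

Lemma nonzeroE w i h : 0 < i -> nonzero (tape_sym w i h) = (0 < h).
Proof. by rewrite /nonzero /tape_sym; case: i => // i _; case: h. Qed.

Definition For (i : nat) (p : cmd) : cmd := While i nonzero (Seq (Dec i) p).

(** The sequence [st] of stores between rounds is given in advance and serves as loop invariant. The
    body starts from a store where register [i] has already been decremented. *)
Lemma exec_For w i p n T (st : nat -> store) :
  0 < i -> (forall m, m <= n -> st m i = n - m) ->
  (forall m, m < n -> exists t, t <= T /\
     exec w p (upd (st m) i (n - m).-1) (st m.+1) t) ->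
  exists t, t <= n.+1 * (T + 4) /\ exec w (For i p) (st 0) (st n) t.
Proof.
move=> i0; elim: n st => [|n IH] st hst hp.
  exists 1; split; first by lia.
  by apply: EWhileF; rewrite nonzeroE // hst.
have [m hm|m hm|t2 [ht2 he2]] := IH (fun m => st m.+1).
- by rewrite hst //; lia.
- by have [t [ht he]] := hp m.+1 hm; exists t.
have [t1 [ht1 he1]] := hp 0 isT.
exists (1 + t1 + t2).+2; split; first by nia.
apply: EWhileT (ESeq _ he1) he2; first by rewrite nonzeroE // hst.
by rewrite -(hst 0 isT); apply: EDec; rewrite i0.
Qed.

(** Level l owns three registers: the value of its variable at 3l + 1 and two scratch registers.
    Register 0 is left to the input head. *)
Definition vreg (l : nat) : nat := (3 * l).+1.

Ltac store_ext :=
  try move=> ?; rewrite /upd ?/vreg /=;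
  repeat (case: eqP => //= ?; subst); try lia.

Definition Move (i j : nat) : cmd := For i (Inc j).

Lemma exec_Move w s i j : 0 < i -> i != j ->
  exists t, t <= (s i).+1 * 5 /\
    exec w (Move i j) s (upd (upd s i 0) j (s j + s i)) t.
Proof.
move=> i0 ij; pose st m := upd (upd s i (s i - m)) j (s j + m).
have [m _|m hm|t [ht he]] := @exec_For w i (Inc j) (s i) 1 st i0.
- by rewrite /st /upd eqxx (negbTE ij).
- exists 1; split=> //.
  rewrite [X in exec _ _ _ X](_ : _ = upd (upd (st m) i (s i - m).-1) j
    (upd (st m) i (s i - m).-1 j).+1); first exact: EInc.
  by rewrite /st; apply: functional_extensionality; store_ext.
exists t; split; first by lia.
rewrite [s in exec _ _ s](_ : _ = st 0); last by rewrite /st; apply: functional_extensionality; store_ext.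
rewrite [X in exec _ _ _ X](_ : _ = st (s i)) //.
by rewrite /st; apply: functional_extensionality; store_ext.
Qed.

(** A counter can be read only by emptying it, so its content goes to [tmp] and is moved back while
    [r] is increased. *)
Definition Copy (v tmp r : nat) : cmd :=
  Seq (Move v tmp) (For tmp (Seq (Inc v) (Inc r))).

Lemma exec_eq w p s s1 s2 t : exec w p s s1 t -> s1 =1 s2 -> exec w p s s2 t.
Proof. by move=> h /functional_extensionality <-. Qed.

Lemma exec_IncInc w i j s : i != j ->
  exec w (Seq (Inc i) (Inc j)) s (upd (upd s i (s i).+1) j (s j).+1) 2.
Proof.
move=> ij; apply: (@ESeq _ _ _ _ _ _ 1 1); first exact: EInc.
by apply: exec_eq (EInc _ _ _) _; store_ext.
Qed.

Lemma exec_Copy w s v tmp r :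
  0 < v -> 0 < tmp -> v != tmp -> r != tmp -> v != r -> s tmp = 0 ->
  exists t, t <= (s v).+1 * 11 /\
    exec w (Copy v tmp r) s (upd s r (s r + s v)) t.
Proof.
move=> v0 tmp0 vt rt vr s0.
have [t1 [ht1 he1]] := exec_Move w s v0 vt.
pose st m := upd (upd (upd s v m) tmp (s v - m)) r (s r + m).
have [m _|m hm|t2 [ht2 he2]] :=
  @exec_For w tmp (Seq (Inc v) (Inc r)) (s v) 2 st tmp0.
- by rewrite /st; store_ext.
- exists 2; split=> //; apply: exec_eq (exec_IncInc _ _ vr) _.
  by rewrite /st; store_ext.
exists (t1 + t2); split; first by lia.
apply: ESeq he1 _; rewrite [X in exec _ _ X](_ : _ = st 0).
  by apply: exec_eq he2 _; rewrite /st; store_ext.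
by apply: functional_extensionality; rewrite /st; store_ext.
Qed.

(* Adds the value of a term to register [r]. The registers from [f] on are
   scratch space, which is left null. *)
Fixpoint tcode (d f r : nat) (t : term) : cmd :=
  match t with
  | TVar l => if l < d then Copy (vreg l) f r else Skip
  | TCst n => iter n (Seq (Inc r)) Skip
  | TAdd t1 t2 => Seq (tcode d f r t1) (tcode d f r t2)
  | TMul t1 t2 => Seq (tcode d f.+1 f t1) (For f (tcode d f.+1 r t2))
  end.

Fixpoint tbound (t : term) (B : nat) : nat :=
  match t with
  | TVar _ => B
  | TCst n => n
  | TAdd t1 t2 => tbound t1 B + tbound t2 B
  | TMul t1 t2 => tbound t1 B * tbound t2 B
  end.

Lemma pbounded_tbound t : pbounded (tbound t).
Proof.
elim: t => [l|n|t1 IH1 t2 IH2|t1 IH1 t2 IH2] /=.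
- exact: pbounded_id.
- exact: pbounded_cst.
- exact: pbounded_add.
- exact: pbounded_mul.
Qed.

Lemma teval_bound e B t : (forall l, nth 0 e l <= B) -> teval e t <= tbound t B.
Proof.
by move=> hB; elim: t => //= t1 IH1 t2 IH2; rewrite ?leq_add ?leq_mul.
Qed.

Lemma exec_tcode t : exists T, pbounded T /\
  forall d w e B f r s, size e = d -> (forall l, nth 0 e l <= B) ->
  (forall l, l < d -> s (vreg l) = nth 0 e l) ->
  (forall i, f <= i -> s i = 0) -> 3 * d < r -> r < f ->
  exists tm, tm <= T B /\
    exec w (tcode d f r t) s (upd s r (s r + teval e t)) tm.
Proof.
elim: t => [l|n|t1 [T1 [hT1 IH1]] t2 [T2 [hT2 IH2]]
              |t1 [T1 [hT1 IH1]] t2 [T2 [hT2 IH2]]].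
- exists (fun B => (B + 1) * 11); split.
    by apply/pbounded_mul/pbounded_cst/pbounded_add/pbounded_cst/pbounded_id.
  move=> d w e B f r s de hB hs hf dr rf /=.
  have [ld|ld] := ltnP l d.
    have [||||||tm [htm he]] := @exec_Copy w s (vreg l) f r; rewrite /vreg;
      try lia.
      by rewrite hf.
    exists tm; split; last by rewrite -hs.
    by apply: leq_trans htm _; have := hB l; rewrite -hs //; lia.
  exists 0; split=> //; rewrite nth_default ?de //.
  by apply: exec_eq (ESkip _ _) _; store_ext.
- exists (fun=> n); split; first exact: pbounded_cst.
  move=> d w e B f r s _ _ _ _ _ _ /=; exists n; split=> //.
  elim: n s => [|n IH] s; first by apply: exec_eq (ESkip _ _) _; store_ext.
  apply: (@ESeq _ _ _ _ _ _ 1 n); first exact: EInc.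
  by apply: exec_eq (IH _) _; store_ext.
- exists (fun B => T1 B + T2 B); split; first exact: pbounded_add.
  move=> d w e B f r s de hB hs hf dr rf.
  have [tm1 [htm1 he1]] := IH1 _ w _ _ _ _ _ de hB hs hf dr rf.
  have [||tm2 [htm2 he2]] :=
    IH2 d w e B f r (upd s r (s r + teval e t1)) de hB _ _ dr rf.
  - move=> l ld; rewrite -hs // /upd /vreg; case: eqP => //; lia.
  - move=> i fi; rewrite /upd -(hf i) //; case: eqP => //; lia.
  exists (tm1 + tm2); split; first exact: leq_add.
  apply: ESeq he1 _; apply: exec_eq he2 _ => /=.
  by store_ext.
- exists (fun B => T1 B + (tbound t1 B + 1) * (T2 B + 4)); split.
    apply: pbounded_add => //; apply: pbounded_mul; apply: pbounded_add => //;
    by [exact: pbounded_tbound|exact: pbounded_cst].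
  move=> d w e B f r s de hB hs hf dr rf.
  have [||tm1 [htm1 he1]] := IH1 d w e B f.+1 f s de hB hs _ _ (ltnSn _).
  - by move=> i fi; rewrite hf // ltnW.
  - exact: ltn_trans rf.
  pose n := teval e t1; rewrite hf // add0n -/n in he1.
  pose st m := upd (upd s f (n - m)) r (s r + m * teval e t2).
  have [|m _|m hm|tm2 [htm2 he2]] :=
    @exec_For w f (tcode d f.+1 r t2) n (T2 B) st.
  - by lia.
  - by rewrite /st; store_ext.
  - have [||tm [htm he]] := IH2 d w e B f.+1 r
      (upd (st m) f (n - m).-1) de hB _ _ dr (ltnW rf).
    + move=> l ld; rewrite -hs // /st /upd /vreg; do 3?case: eqP => //; lia.
    + move=> i fi; rewrite -(hf i (ltnW fi)) /st /upd; do 3?case: eqP => //; lia.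
    exists tm; split=> //; apply: exec_eq he _.
    by rewrite /st; store_ext.
  exists (tm1 + tm2); split.
    apply: leq_add => //; apply: leq_trans htm2 _; rewrite addn1 leq_mul //.
    by rewrite ltnS teval_bound.
  apply: ESeq he1 _; rewrite [X in exec _ _ X](_ : _ = st 0).
    have hff := hf f (leqnn _).
    by apply: exec_eq he2 _; rewrite /st -/n /=; store_ext.
  by apply: functional_extensionality; rewrite /st; store_ext.
Qed.

(* The flag computed by [c] replaces the value in [vreg d], the register of the
   next variable to be bound. *)
Definition decides (d : nat) (c : cmd) (P : seq bool -> seq nat -> bool) :=
  exists T, pbounded T /\
  forall w e B s, size e = d -> (forall l, nth 0 e l <= B) -> s 0 = 0 ->
  (forall l, l < d -> s (vreg l) = nth 0 e l) ->
  (forall i, 3 * d < i -> s i = 0) ->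
  exists t, t <= T B /\ exec w c s (upd s (vreg d) (P w e)) t.

Definition is_true_bit : pred sym := fun x => x == Some (inl true).

Definition is_bit : pred sym := fun x => if x is Some (inl _) then true else false.

Lemma is_true_bitE w h : is_true_bit (tape_sym w 0 h) = nth false w h.
Proof.
rewrite /is_true_bit /tape_sym /=; have [hw|hw] := ltnP h (size w).
  by rewrite (nth_map false) //; case: (nth _ _ _).
by rewrite !nth_default ?size_map.
Qed.

(** The head of the input must return to its start, which is not marked; register [3 * d + 3]
    remembers how far it went. *)
Definition bit_code (d : nat) (t : term) : cmd :=
  Seq (tcode d (3 * d + 4) (3 * d + 2) t)
  (Seq (For (3 * d + 2) (Seq (Inc 0) (Inc (3 * d + 3))))
  (Seq (If 0 is_true_bit (Inc (vreg d)) Skip)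
       (For (3 * d + 3) (Dec 0)))).

(** Decrements stop at 0, so what remains of the second value after subtracting the first is nonzero
    exactly when the first is smaller. The remainder is then cleared, as scratch registers must end
    null. *)
Definition lt_code (d : nat) (t1 t2 : term) : cmd :=
  Seq (tcode d (3 * d + 4) (3 * d + 2) t1)
  (Seq (tcode d (3 * d + 4) (3 * d + 3) t2)
  (Seq (For (3 * d + 2) (Dec (3 * d + 3)))
       (If (3 * d + 3) nonzero
          (Seq (Inc (vreg d)) (For (3 * d + 3) Skip)) Skip))).

Definition not_code (d : nat) (c : cmd) : cmd :=
  Seq c (If (vreg d) nonzero (Dec (vreg d)) (Inc (vreg d))).

(** The flag is reset before [c2] runs because [decides] assumes null registers above [3 * d]. *)
Definition and_code (d : nat) (c1 c2 : cmd) : cmd :=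
  Seq c1 (If (vreg d) nonzero (Seq (Dec (vreg d)) c2) Skip).

(** The loop cannot be left early, so failures are counted in [3 * d + 3]. Register [3 * d + 2]
    counts the rounds down, while [vreg d] counts up and is the value of the bound variable. *)
Definition all_code (d : nat) (t : term) (c : cmd) : cmd :=
  Seq (tcode d (3 * d + 4) (3 * d + 2) t)
  (Seq (For (3 * d + 2)
         (Seq c (Seq (If (vreg d.+1) nonzero
                        (Dec (vreg d.+1)) (Inc (3 * d + 3)))
                     (Inc (vreg d)))))
  (Seq (For (vreg d) Skip)
       (If (3 * d + 3) nonzero (For (3 * d + 3) Skip) (Inc (vreg d))))).

Lemma exec_Clear w s i : 0 < i ->
  exists t, t <= (s i).+1 * 4 /\ exec w (For i Skip) s (upd s i 0) t.
Proof.
move=> i0; pose st m := upd s i (s i - m).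
have [m _|m hm|t [ht he]] := @exec_For w i Skip (s i) 0 st i0.
- by rewrite /st; store_ext.
- exists 0; split=> //; apply: exec_eq (ESkip _ _) _.
  by rewrite /st; store_ext.
exists t; split=> //; rewrite [X in exec _ _ X](_ : _ = st 0).
  by apply: exec_eq he _; rewrite /st; store_ext.
by apply: functional_extensionality; rewrite /st; store_ext.
Qed.

Lemma exec_tcode_at d t : exists T, pbounded T /\
  forall w e B r s, size e = d -> (forall l, nth 0 e l <= B) ->
  (forall l, l < d -> s (vreg l) = nth 0 e l) ->
  (forall i, 3 * d + 4 <= i -> s i = 0) -> 3 * d < r -> r < 3 * d + 4 ->
  exists tm, tm <= T B /\
    exec w (tcode d (3 * d + 4) r t) s (upd s r (s r + teval e t)) tm.
Proof.
have [T [hT h]] := exec_tcode t; exists T; split=> // w e B r s de hB hs hf dr rf.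
exact: h.
Qed.

Lemma decides_bit d t :
  decides d (bit_code d t) (fun w e => nth false w (teval e t)).
Proof.
have [T [hT ht]] := exec_tcode_at d t.
exists (fun B => T B + (tbound t B + 1) * (2 + 4) +
                 (3 + (tbound t B + 1) * (1 + 4))); split.
  do ?[apply: pbounded_add => // | apply: pbounded_mul];
    do ?[exact: pbounded_cst | exact: pbounded_tbound | apply: pbounded_add].
move=> w e B s de hB s0 hs hf.
have hbt := teval_bound t hB; set n := teval e t in hbt *.
have [|||t1 [ht1 he1]] := ht w e B (3 * d + 2) s de hB hs; try by lia.
  by move=> i hi; apply: hf; lia.
rewrite (hf (3 * d + 2)) ?add0n -/n in he1; last by lia.
pose st m := upd (upd (upd s (3 * d + 2) (n - m)) 0 m) (3 * d + 3) m.
have d3 := hf (3 * d + 3); have d2 := hf (3 * d + 2).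
have [|m _|m hm|t2 [ht2 he2]] := @exec_For w (3 * d + 2)
   (Seq (Inc 0) (Inc (3 * d + 3))) n 2 st; first by lia.
- by rewrite /st; store_ext.
- exists 2; split=> //; apply: exec_eq (exec_IncInc _ _ _) _; first by lia.
  by rewrite /st; store_ext.
set b := nth false w n.
have [t3 [ht3 he3]] : exists t, t <= 2 + 1 /\
    exec w (If 0 is_true_bit (Inc (vreg d)) Skip) (st n)
      (upd (st n) (vreg d) b) t.
  have hb : is_true_bit (tape_sym w 0 (st n 0)) = b.
    by rewrite is_true_bitE /st /b; congr nth; store_ext.
  have := hf (vreg d); rewrite /vreg => hv.
  case: (b) hb => hb; [exists 3|exists 1]; split=> //.
    by apply: EIfT hb _; apply: exec_eq (EInc _ _ _) _; rewrite /st; store_ext.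
  apply: EIfF (negbT hb) _.
  by apply: exec_eq (ESkip _ _) _; rewrite /st; store_ext.
pose st' m := upd (upd (upd s (vreg d) b) 0 (n - m)) (3 * d + 3) (n - m).
have [|m _|m hm|t4 [ht4 he4]] := @exec_For w (3 * d + 3) (Dec 0) n 1 st';
  first by lia.
- by rewrite /st'; store_ext.
- exists 1; split=> //; apply: exec_eq (EDec _ _) _.
    by apply/orP; right; rewrite /st'; store_ext.
  by rewrite /st'; store_ext.
exists (t1 + (t2 + (t3 + t4))); split; first by lia.
apply: ESeq he1 (ESeq _ (ESeq he3 _)).
  rewrite [X in exec _ _ X](_ : _ = st 0) //.
  by apply: functional_extensionality; rewrite /st; store_ext.
rewrite [X in exec _ _ X](_ : _ = st' 0) //.
  by apply: exec_eq he4 _; rewrite /st'; store_ext.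
by apply: functional_extensionality; rewrite /st /st'; store_ext.
Qed.

Lemma decides_lt d t1 t2 :
  decides d (lt_code d t1 t2) (fun w e => teval e t1 < teval e t2).
Proof.
have [T1 [hT1 htc1]] := exec_tcode_at d t1.
have [T2 [hT2 htc2]] := exec_tcode_at d t2.
exists (fun B => T1 B + T2 B + (tbound t1 B + 1) * (1 + 4) +
                 (3 + (tbound t2 B + 1) * 4)); split.
  do ?[apply: pbounded_add => // | apply: pbounded_mul];
    do ?[exact: pbounded_cst | exact: pbounded_tbound | apply: pbounded_add].
move=> w e B s de hB s0 hs hf.
have hb1 := teval_bound t1 hB; have hb2 := teval_bound t2 hB.
have [|||tm1 [ht1 he1]] := htc1 w e B (3 * d + 2) s de hB hs; try by lia.
  by move=> i hi; apply: hf; lia.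
pose s1 := upd s (3 * d + 2) (s (3 * d + 2) + teval e t1).
have [||||tm2 [ht2 he2]] := htc2 w e B (3 * d + 3) s1 de hB; try by lia.
- by move=> l ld; rewrite -hs // /s1; store_ext.
- by move=> i hi; rewrite -(hf i); [rewrite /s1; store_ext|lia].
set n1 := teval e t1 in hb1 he1 s1 he2 *; set n2 := teval e t2 in hb2 he2 *.
have d3 := hf (3 * d + 3); have d2 := hf (3 * d + 2);
  have hv : s (3 * d).+1 = 0 by apply: hf.
pose st m := upd (upd s (3 * d + 2) (n1 - m)) (3 * d + 3) (n2 - m).
have [|m _|m hm|tm3 [ht3 he3]] := @exec_For w (3 * d + 2)
   (Dec (3 * d + 3)) n1 1 st; first by lia.
- by rewrite /st; store_ext.
- exists 1; split=> //; apply: exec_eq (EDec _ _) _; first by apply/orP; lia.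
  by rewrite /st; store_ext.
have [tm4 [ht4 he4]] : exists t, t <= 3 + n2.+1 * 4 /\
    exec w (If (3 * d + 3) nonzero
          (Seq (Inc (vreg d)) (For (3 * d + 3) Skip)) Skip) (st n1)
      (upd s (vreg d) (n1 < n2)) t.
  have h3 : nonzero (tape_sym w (3 * d + 3) (st n1 (3 * d + 3))) = (n1 < n2).
    have e3 : st n1 (3 * d + 3) = n2 - n1 by rewrite /st; store_ext.
    by rewrite nonzeroE ?e3 ?subn_gt0 //; lia.
  case: ltnP h3 => h h3; last first.
    exists 1; split=> //; apply: EIfF (negbT h3) _.
    by apply: exec_eq (ESkip _ _) _; rewrite /st; store_ext.
  have [|t [ht he]] := @exec_Clear w (upd (st n1) (vreg d) (st n1 (vreg d)).+1)
    (3 * d + 3); first by lia.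
  exists (1 + t).+2; split.
    rewrite [X in _ <= X.+1 * 4](_ : _ = n2 - n1) in ht; first by lia.
    by rewrite /st; store_ext.
  apply: EIfT h3 _; apply: ESeq (EInc _ _ _) _; apply: exec_eq he _.
  by rewrite /st; store_ext.
exists (tm1 + (tm2 + (tm3 + tm4))); split; first by nia.
apply: ESeq he1 (ESeq he2 (ESeq _ he4)).
rewrite [X in exec _ _ X](_ : _ = st 0) //.
by apply: functional_extensionality; rewrite /s1 /st; store_ext.
Qed.

Lemma decides_not d c P :
  decides d c P -> decides d (not_code d c) (fun w e => ~~ P w e).
Proof.
move=> [T [hT ht]]; exists (fun B => T B + 3); split.
  exact/pbounded_add/pbounded_cst.
move=> w e B s de hB s0 hs hf.
have [t [htm he]] := ht w e B s de hB s0 hs hf;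
  have hv : s (3 * d).+1 = 0 by apply: hf.
suff [t2 [ht2 he2]] : exists t, t <= 3 /\
    exec w (If (vreg d) nonzero (Dec (vreg d)) (Inc (vreg d)))
      (upd s (vreg d) (P w e)) (upd s (vreg d) (~~ P w e)) t.
  by exists (t + t2); split; [lia|exact: ESeq he he2].
have h3 : nonzero (tape_sym w (vreg d) (upd s (vreg d) (P w e) (vreg d))) = P w e.
  by rewrite nonzeroE // /upd eqxx; case: (P w e).
case: (P w e) h3 => h3; [exists 3|exists 2]; split=> //.
  by apply: EIfT h3 _; apply: exec_eq (EDec _ _) _; store_ext.
by apply: EIfF (negbT h3) _; apply: exec_eq (EInc _ _ _) _; store_ext.
Qed.

Lemma decides_and d c1 c2 P1 P2 : decides d c1 P1 -> decides d c2 P2 ->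
  decides d (and_code d c1 c2) (fun w e => P1 w e && P2 w e).
Proof.
move=> [T1 [hT1 ht1]] [T2 [hT2 ht2]]; exists (fun B => T1 B + (T2 B + 3)); split.
  by apply: pbounded_add => //; exact/pbounded_add/pbounded_cst.
move=> w e B s de hB s0 hs hf.
have [t [htm he]] := ht1 w e B s de hB s0 hs hf;
  have hv : s (3 * d).+1 = 0 by apply: hf.
have [t2 [htm2 he2]] := ht2 w e B s de hB s0 hs hf.
suff [t3 [ht3 he3]] : exists t, t <= T2 B + 3 /\
    exec w (If (vreg d) nonzero (Seq (Dec (vreg d)) c2) Skip)
      (upd s (vreg d) (P1 w e)) (upd s (vreg d) (P1 w e && P2 w e)) t.
  by exists (t + t3); split; [lia|exact: ESeq he he3].
have h3 : nonzero (tape_sym w (vreg d) (upd s (vreg d) (P1 w e) (vreg d))) = P1 w e.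
  by rewrite nonzeroE // /upd eqxx; case: (P1 w e).
case: (P1 w e) h3 => h3; last first.
  exists 1; split; first by lia.
  by apply: EIfF (negbT h3) _; apply: exec_eq (ESkip _ _) _; store_ext.
exists (1 + t2).+2; split; first by lia.
apply: EIfT h3 _; apply: ESeq (EDec _ _) _; first by [].
rewrite [X in exec _ _ X](_ : _ = s) //.
by apply: functional_extensionality; store_ext.
Qed.

Lemma decides_all d t c P : decides d.+1 c P ->
  decides d (all_code d t c)
    (fun w e => all (fun i => P w (rcons e i)) (iota 0 (teval e t))).
Proof.
move=> [T1 [hT1 ht1]].
have [T [hT htc]] := exec_tcode_at d t.
exists (fun B => T B + (tbound t B + 1) * (T1 (B + tbound t B) + 4 + 4) +
                 (tbound t B + 1) * 4 + ((tbound t B + 1) * 4 + 3)); split.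
  (* The new variable stays below the value of [t], so the body sees values up to [B + tbound t B];
     this composition of bounds is again polynomial. *)
  have hTc := pbounded_comp hT1 (pbounded_add pbounded_id (pbounded_tbound t)).
  by do ?[apply: pbounded_add => // | apply: pbounded_mul];
    do ?[exact: pbounded_cst | exact: pbounded_tbound | apply: pbounded_add].
move=> w e B s de hB s0 hs hf.
have hbt := teval_bound t hB; set n := teval e t in hbt *.
have [|||tm1 [htm1 he1]] := htc w e B (3 * d + 2) s de hB hs; try by lia.
  by move=> i hi; apply: hf; lia.
rewrite (hf (3 * d + 2)) ?add0n -/n in he1; last by lia.
have d3 := hf (3 * d + 3); have d2 := hf (3 * d + 2);
  have hv : s (3 * d).+1 = 0 by apply: hf.
have d4 : s (3 * d.+1).+1 = 0 by apply: hf; lia.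
pose fails m := count (fun i => ~~ P w (rcons e i)) (iota 0 m).
pose st m := upd (upd (upd s (vreg d) m) (3 * d + 2) (n - m))
                 (3 * d + 3) (fails m).
have [|m _|m hm|tm2 [htm2 he2]] := @exec_For w (3 * d + 2)
   (Seq c (Seq (If (vreg d.+1) nonzero (Dec (vreg d.+1)) (Inc (3 * d + 3)))
               (Inc (vreg d)))) n (T1 (B + tbound t B) + 4) st; first by lia.
- by rewrite /st; store_ext.
- pose sm := upd (st m) (3 * d + 2) (n - m).-1.
  have [|l||l ld|i hi|t1 [htm he]] :=
      ht1 w (rcons e m) (B + tbound t B) sm.
  + by rewrite size_rcons de.
  + rewrite nth_rcons de; case: ltnP => ld; first by have := hB l; lia.
    by case: eqP => _; lia.
  + by rewrite /sm /st; store_ext.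
  + rewrite nth_rcons de; case: ltnP => ld'.
      by rewrite -hs // /sm /st; store_ext.
    have -> : l = d by lia.
    by rewrite eqxx /sm /st; store_ext.
  + have hfi := hf i; rewrite /sm /st; store_ext.
  pose b := P w (rcons e m); rewrite -/b in he.
  have failsS : fails m.+1 = fails m + ~~ b.
    by rewrite /fails -addn1 iotaD count_cat /= addn0.
  have [t2 [htm2 he2]] : exists t, t <= 3 /\
      exec w (If (vreg d.+1) nonzero (Dec (vreg d.+1)) (Inc (3 * d + 3)))
        (upd sm (vreg d.+1) b) (upd (upd (st m.+1) (vreg d) m)
           (3 * d + 2) (n - m).-1) t.
    have h3 : nonzero (tape_sym w (vreg d.+1) (upd sm (vreg d.+1) b (vreg d.+1))) = b.
      by rewrite nonzeroE // /upd eqxx; case: (b).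
    case: (b) h3 failsS => h3 failsS; [exists 3|exists 2]; split=> //.
      apply: EIfT h3 _; apply: exec_eq (EDec _ _) _; first by [].
      by rewrite /sm /st; store_ext.
    apply: EIfF (negbT h3) _; apply: exec_eq (EInc _ _ _) _.
    by rewrite /sm /st; store_ext.
  exists (t1 + (t2 + 1)); split; first by lia.
  apply: ESeq he (ESeq he2 _); apply: exec_eq (EInc _ _ _) _.
  by rewrite /st; store_ext.
have [|tm3 [htm3 he3]] := @exec_Clear w (st n) (vreg d); first by [].
pose r := all (fun i => P w (rcons e i)) (iota 0 n).
have failsn : (fails n == 0) = r.
  by rewrite /r eqn0Ngt -has_count (has_predC (fun i : nat => P w (rcons e i))) negbK.
have failsle : fails n <= n by rewrite -[X in _ <= X](size_iota 0 n) count_size.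
have [tm4 [htm4 he4]] : exists tm, tm <= (tbound t B + 1) * 4 + 3 /\
    exec w (If (3 * d + 3) nonzero (For (3 * d + 3) Skip) (Inc (vreg d)))
      (upd (st n) (vreg d) 0) (upd s (vreg d) r) tm.
  have h3 : nonzero (tape_sym w (3 * d + 3) (upd (st n) (vreg d) 0 (3 * d + 3))) = ~~ r.
    have e3 : upd (st n) (vreg d) 0 (3 * d + 3) = fails n.
      by rewrite /st; store_ext.
    by rewrite nonzeroE ?e3 -?failsn -?lt0n //; lia.
  case: (r) failsn h3 => /= failsn h3.
    exists 2; split; first by lia.
    apply: EIfF (negbT h3) _; apply: exec_eq (EInc _ _ _) _.
    by rewrite /st; store_ext.
  have [|t1 [htm he]] := @exec_Clear w (upd (st n) (vreg d) 0) (3 * d + 3);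
    first by lia.
  exists t1.+2; split.
    rewrite [X in _ <= X.+1 * 4](_ : _ = fails n) in htm; first by lia.
    by rewrite /st; store_ext.
  apply: EIfT h3 _; apply: exec_eq he _.
  by rewrite /st; store_ext.
exists (tm1 + (tm2 + (tm3 + tm4))); split.
  rewrite [X in _ <= X.+1 * 4](_ : _ = n) in htm3; first by nia.
  by rewrite /st; store_ext.
apply: ESeq he1 (ESeq _ (ESeq he3 he4)).
rewrite [X in exec _ _ X](_ : _ = st 0) //.
by apply: functional_extensionality; rewrite /st /fails /=; store_ext.
Qed.

Lemma decides_ext d c P Q : (forall w e, P w e = Q w e) ->
  decides d c P -> decides d c Q.
Proof.
move=> PQ [T [hT ht]]; exists T; split=> // w e B s h1 h2 h3 h4 h5.
by rewrite -PQ; apply: ht.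
Qed.

Fixpoint fcode (d : nat) (f : form) : cmd :=
  match f with
  | FBit t => bit_code d t
  | FLt t1 t2 => lt_code d t1 t2
  | FEq t1 t2 =>
      and_code d (not_code d (lt_code d t1 t2)) (not_code d (lt_code d t2 t1))
  | FNot f1 => not_code d (fcode d f1)
  | FAnd f1 f2 => and_code d (fcode d f1) (fcode d f2)
  | FOr f1 f2 =>
      not_code d
        (and_code d (not_code d (fcode d f1)) (not_code d (fcode d f2)))
  | FImp f1 f2 =>
      not_code d (and_code d (fcode d f1) (not_code d (fcode d f2)))
  | FAll t f1 => all_code d t (fcode d.+1 f1)
  | FEx t f1 => not_code d (all_code d t (not_code d.+1 (fcode d.+1 f1)))
  end.

Lemma decides_fcode f d : decides d (fcode d f) (fun w e => fval w e f).
Proof.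
elim: f d => [t|t1 t2|t1 t2|f1 IH|f1 IH1 f2 IH2|f1 IH1 f2 IH2|f1 IH1 f2 IH2
  |t f1 IH|t f1 IH] d /=.
- exact: decides_bit.
- exact: decides_lt.
- apply: decides_ext (decides_and (decides_not (decides_lt d t1 t2))
                                  (decides_not (decides_lt d t2 t1))).
  by move=> w e /=; rewrite -!leqNgt andbC eqn_leq.
- exact: decides_not.
- exact: decides_and.
- apply: decides_ext
    (decides_not (decides_and (decides_not (IH1 d)) (decides_not (IH2 d)))).
  by move=> w e /=; rewrite negb_and !negbK.
- apply: decides_ext (decides_not (decides_and (IH1 d) (decides_not (IH2 d)))).
  by move=> w e /=; rewrite negb_and negbK implybE.
- exact: (decides_all t (IH d.+1)).
- apply: decides_ext (decides_not (decides_all t (decides_not (IH d.+1)))).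
  by move=> w e /=; rewrite all_predC negbK.
Qed.

(** Register 1 is [vreg 0], so the length becomes the value of the outermost variable; register 2
    counts the moves needed to bring the head back. *)
Definition len_code : cmd :=
  Seq (While 0 is_bit (Seq (Inc 0) (Seq (Inc 1) (Inc 2)))) (For 2 (Dec 0)).

Lemma exec_len w : exists t, t <= (size w).+1 * 10 /\
  exec w len_code (fun=> 0) (upd (fun=> 0) 1 (size w)) t.
Proof.
pose st m := upd (upd (upd (fun=> 0) 0 m) 1 m) 2 m.
have bitE m : is_bit (tape_sym w 0 m) = (m < size w).
  rewrite /tape_sym /=; case: ltnP => hm; first by rewrite (nth_map false).
  by rewrite nth_default // size_map.
have [t1 [ht1 he1]] : exists t, t <= (size w).*2 + (size w) * 3 + 1 /\
    exec w (While 0 is_bit (Seq (Inc 0) (Seq (Inc 1) (Inc 2)))) (st 0)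
      (st (size w)) t.
  suff H n m : n + m = size w -> exists t, t <= n.*2 + n * 3 + 1 /\
      exec w (While 0 is_bit (Seq (Inc 0) (Seq (Inc 1) (Inc 2)))) (st m)
        (st (size w)) t.
    by apply: H; rewrite addn0.
  elim: n m => [|n IH] m hn.
    exists 1; split; first by lia.
    rewrite -hn add0n; apply: EWhileF; rewrite bitE /st /upd /=; lia.
  have [|t [ht he]] := IH m.+1; first by lia.
  exists ((1 + (1 + 1)) + t).+2; split; first by lia.
  apply: EWhileT he; first by rewrite bitE /st /upd /=; lia.
  apply: (ESeq (EInc _ _ _)); apply: (ESeq (EInc _ _ _)).
  by apply: exec_eq (EInc _ _ _) _; rewrite /st; store_ext.
pose st' m := upd (upd (upd (fun=> 0) 0 (size w - m)) 1 (size w)) 2 (size w - m).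
have [|m _|m hm|t2 [ht2 he2]] := @exec_For w 2 (Dec 0) (size w) 1 st'.
- by [].
- by rewrite /st'; store_ext.
- exists 1; split=> //; apply: exec_eq (EDec _ _) _.
    by apply/orP; right; rewrite /st'; store_ext.
  by rewrite /st'; store_ext.
exists (t1 + t2); split; first by lia.
rewrite [X in exec _ _ X](_ : _ = st 0).
  apply: ESeq he1 _; rewrite [X in exec _ _ X](_ : _ = st' 0).
    by apply: exec_eq he2 _; rewrite /st'; store_ext.
  by apply: functional_extensionality; rewrite /st /st'; store_ext.
by apply: functional_extensionality; rewrite /st; store_ext.
Qed.

Theorem form_poly_decidable f : poly_decidable (fun w => fval w [:: size w] f).
Proof.
have [T [[a ha] hT]] := decides_fcode f 1.
have [|b hb] := @pbounded_add (fun n => n.+1 * 10) T _ (ex_intro _ a ha).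
  apply: pbounded_mul (pbounded_cst _).
  apply: (@pbounded_le _ (fun n => n + 1)); first by move=> n; rewrite addn1.
  exact: (pbounded_add pbounded_id (pbounded_cst 1)).
apply: (@exec_poly_decidable _ (Seq len_code (fcode 1 f)) (vreg 1) b) => // w.
have [t1 [ht1 he1]] := exec_len w.
have [|[|l]||[]|i hi|t2 [ht2 he2]] :=
    hT w [:: size w] (size w) (upd (fun=> 0) 1 (size w)) => //.
- by rewrite /= nth_nil.
- by rewrite /upd; case: eqP => // ?; lia.
exists (upd (upd (fun=> 0) 1 (size w)) (vreg 1) (fval w [:: size w] f)).
exists (t1 + t2); split.
- exact: ESeq he1 he2.
- by have := hb (size w); rewrite /=; lia.
- by rewrite /upd eqxx; case: (fval _ _ _).
Qed.

(** * Circuits as constraint satisfaction problems *)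

Lemma wire_comparable : comparable wire.
Proof. by move=> u v; rewrite /decidable; decide equality; apply: eq_comparable. Qed.

HB.instance Definition _ := hasDecEq.Build wire (compareP wire_comparable).

Definition gate_in1 (g : gate) : wire :=
  match g with Not u => u | And u _ => u | Or u _ => u end.

Definition gate_in2 (g : gate) : wire :=
  match g with Not u => u | And _ v => v | Or _ v => v end.

Definition gate_fun (g : gate) (b c : bool) : bool :=
  match g with Not _ => ~~ b | And _ _ => b && c | Or _ _ => b || c end.

Lemma gate_valE x z vs g : gate_val x z vs g =
  gate_fun g (wire_val x z vs (gate_in1 g)) (wire_val x z vs (gate_in2 g)).
Proof. by case: g. Qed.

(* The variables of the constraint problem are wire occurrences: n main inputs,
   the output wire, then for each gate its own wire and its two input wires.
   Their number does not depend on the length of the nondeterministic input. *)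
Definition slot (C : circuit) (n i : nat) : option wire :=
  if i < n then Some (Main i)
  else if i == n then Some (c_out C)
  else let g := (i - n.+1) %/ 3 in
    if onth (c_gates C) g is Some G then
      Some (match (i - n.+1) %% 3 with
            | 0 => Gate g
            | 1 => gate_in1 G
            | _ => gate_in2 G
            end)
    else None.

Definition same_wire (C : circuit) (n i j : nat) : bool :=
  (slot C n i != None) && (slot C n i == slot C n j).

Definition gate_clash (C : circuit) (n i j l : nat) (a b c : bool) : bool :=
  [&& n < i, 3 %| i - n.+1, j == i.+1, l == i.+2 &
      if onth (c_gates C) ((i - n.+1) %/ 3) is Some G
      then a != gate_fun G b c else false].

(** The output slot is forced to 0 because a rejecting evaluation is sought. Three positions suffice
    since a gate has at most two inputs. *)
Definition violated (C : circuit) (n i j l : nat) (a b c : bool) : bool :=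
  [|| same_wire C n i j && (a != b), (i == n) && a |
      gate_clash C n i j l a b c].

Lemma size_gate_vals x z gs : size (gate_vals x z gs) = size gs.
Proof.
elim/last_ind: gs => // gs g IH.
by rewrite /gate_vals foldl_rcons !size_rcons -/(gate_vals _ _ _) IH.
Qed.

Lemma gate_vals_take x z gs g :
  gate_vals x z (take g gs) = take g (gate_vals x z gs).
Proof.
elim/last_ind: gs => // gs G IH.
rewrite {2}/gate_vals foldl_rcons -/(gate_vals _ _ _) -cats1 -[rcons _ _]cats1.
rewrite !take_cat size_gate_vals; case: ltnP => // hg.
case: (g - size gs) => [|k] /=; first by rewrite !cats0.
by rewrite cats1 /gate_vals foldl_rcons cats1.
Qed.

Lemma gates_ok_onth n m t gs g G : gates_ok n m t gs -> onth gs g = Some G ->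
  gate_ok n m (t + g) G.
Proof.
elim: gs t g => [|G' gs IH] t [|g] //= /andP[hG hgs].
  by move=> [<-]; rewrite addn0.
by move=> /(IH _ _ hgs); rewrite addSnnS.
Qed.

Lemma gate_okE n m t G :
  gate_ok n m t G = wire_ok n m t (gate_in1 G) && wire_ok n m t (gate_in2 G).
Proof. by case: G => //= u; rewrite andbb. Qed.

Lemma nth_gate_vals n m x z gs g G :
  gates_ok n m 0 gs -> onth gs g = Some G ->
  nth false (gate_vals x z gs) g = gate_val x z (gate_vals x z gs) G.
Proof.
move=> hok hG; have := gates_ok_onth hok hG; rewrite add0n.
have hg : g < size gs by rewrite -onthTE hG.
have eG : nth G gs g = G by exact: onth_nth.
have -> : nth false (gate_vals x z gs) g =
    gate_val x z (take g (gate_vals x z gs)) G.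
  have := nth_take false (ltnSn g) (gate_vals x z gs) => <-.
  rewrite -gate_vals_take (take_nth G) // eG.
  rewrite /gate_vals foldl_rcons -/(gate_vals _ _ _) nth_rcons size_gate_vals.
  by rewrite size_takel ?ltnn ?eqxx ?gate_vals_take // ltnW.
rewrite gate_okE !gate_valE => /andP[h1 h2]; congr gate_fun.
  by case: (gate_in1 G) h1 => //= g1 h; rewrite nth_take.
by case: (gate_in2 G) h2 => //= g2 h; rewrite nth_take.
Qed.

Lemma slot_main C n i : i < n -> slot C n i = Some (Main i).
Proof. by move=> hi; rewrite /slot hi. Qed.

Lemma slot_out C n : slot C n n = Some (c_out C).
Proof. by rewrite /slot ltnn eqxx. Qed.

Lemma slot_gate C n g r G : onth (c_gates C) g = Some G -> r < 3 ->
  slot C n (n.+1 + 3 * g + r) =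
  Some (match r with 0 => Gate g | 1 => gate_in1 G | _ => gate_in2 G end).
Proof.
move=> hG r3; rewrite /slot; case: ltnP => [|_]; first by lia.
case: eqP => [|_]; first by lia.
have -> : n.+1 + 3 * g + r - n.+1 = g * 3 + r by lia.
by rewrite divnMDl // modnMDl modn_small // (divn_small r3) addn0 hG.
Qed.

Lemma slotP C n i w : slot C n i = Some w ->
  [\/ i < n /\ w = Main i, i = n /\ w = c_out C
    | exists g r G, [/\ onth (c_gates C) g = Some G, r < 3,
        i = n.+1 + 3 * g + r &
        w = match r with 0 => Gate g | 1 => gate_in1 G | _ => gate_in2 G end]].
Proof.
rewrite /slot; case: ltnP => [hi [<-]|ni]; first by constructor 1.
case: eqP => [hi [<-]|/eqP hi]; first by constructor 2.
case hG: (onth _ _) => [G|] // [<-]; constructor 3.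
exists ((i - n.+1) %/ 3), ((i - n.+1) %% 3), G; split=> //.
  by rewrite ltn_mod.
by have := divn_eq (i - n.+1) 3; lia.
Qed.

Lemma slot_ok C n i w : circuit_ok n C -> slot C n i = Some w ->
  wire_ok n (c_aux C) (size (c_gates C)) w.
Proof.
move=> /andP[hg ho] /slotP[[hi ->] //|[_ ->] //|[g [r [G [hG hr _ ->]]]]].
have hs : g < size (c_gates C) by rewrite -onthTE hG.
have := gates_ok_onth hg hG; rewrite gate_okE add0n => /andP[h1 h2].
have W w' : wire_ok n (c_aux C) g w' -> wire_ok n (c_aux C) (size (c_gates C)) w'.
  by case: w' => //= h /ltn_trans; apply.
by case: r hr => [|[|r]] // _; apply: W.
Qed.

(** A rejecting z gives every slot the value of its wire. Conversely, slots with a common wire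
    agree, so z can be read off the assignment, and induction along the gates shows that the slots
    hold the computed values. Slots without a wire are unconstrained, so N may exceed the number of
    slots. *)
Lemma circuit_constraints C n N (x : seq bool) :
  circuit_ok n C -> n.+1 + 3 * circuit_size C <= N -> size x = n ->
  (exists z : (c_aux C).-tuple bool, ~~ circuit_eval C x z) <->
  (exists v : nat -> bool, (forall i, i < n -> v i = nth false x i) /\
     forall i j l, i < N -> j < N -> l < N ->
       ~~ violated C n i j l (v i) (v j) (v l)).
Proof.
move=> hC hN hx; have /andP[hgs hout] := hC; split=> [[z hz]|[v [hv hviol]]].
  pose vs := gate_vals x z (c_gates C).
  exists (fun i => if slot C n i is Some w then wire_val x z vs w else false).
  split=> [i hi|i j l _ _ _]; first by rewrite slot_main.
  rewrite /violated !negb_or; apply/and3P; split.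
  - rewrite /same_wire; case: (slot C n i) => // w.
    case: (Some w =P slot C n j) => //= <-.
    by rewrite eqxx.
  - case: eqP => //= ->; rewrite slot_out; exact: hz.
  - apply/negP => /and5P[ni d3 /eqP hj /eqP hl].
    set g := (i - n.+1) %/ 3; case hG: (onth _ _) => [G|] //.
    have iE : i = n.+1 + 3 * g + 0.
      by move: (divnK d3); rewrite -/g; lia.
    have -> : j = n.+1 + 3 * g + 1 by lia.
    have -> : l = n.+1 + 3 * g + 2 by lia.
    rewrite {1}iE !(slot_gate _ hG) //= (nth_gate_vals _ _ hgs hG) gate_valE.
    by rewrite eqxx.
have hsame i j w : i < N -> j < N -> slot C n i = Some w ->
    slot C n j = Some w -> v i = v j.
  move=> hi hj si sj; have := hviol i j i hi hj hi.
  rewrite /violated /same_wire si sj eqxx /= !negb_or => /andP[] /negPn/eqP.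
  by [].
(* Bit j is the common value of the slots that carry [Aux j], and false if there are none. *)
pose z := [tuple has (fun i => (slot C n i == Some (Aux j)) && v i) (iota 0 N)
          | j < c_aux C].
have zE i j : i < N -> slot C n i = Some (Aux j) -> nth false z j = v i.
  move=> hi si; have jm := slot_ok hC si.
  rewrite -[j]/(nat_of_ord (Ordinal jm)) -tnth_nth tnth_mktuple.
  apply/hasP/idP => [[i' ]|vi]; last first.
    by exists i; rewrite ?mem_iota ?si ?eqxx.
  rewrite mem_iota add0n => /andP[_ hi'] /andP[/eqP si'].
  by rewrite (hsame i' i (Aux j)).
exists z; pose vs := gate_vals x z (c_gates C).
have gateE g : g < size (c_gates C) -> nth false vs g = v (n.+1 + 3 * g).
  elim/ltn_ind: g => g IH hg.
  case hG: (onth (c_gates C) g) => [G|]; last by move: hg; rewrite -onthTE hG.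
  rewrite /vs (nth_gate_vals _ _ hgs hG) -/vs gate_valE.
  have := gates_ok_onth hgs hG; rewrite gate_okE add0n => /andP[h1 h2].
  have hgN : n.+1 + 3 * g + 2 < N by rewrite /circuit_size in hN; lia.
  have wE w i : wire_ok n (c_aux C) g w -> i < N -> slot C n i = Some w ->
      wire_val x z vs w = v i.
    case: w => [p|j|h] /= ok hi si; last 1 first.
    - rewrite IH //; last exact: ltn_trans hg.
      have hh : h < size (c_gates C) by exact: ltn_trans hg.
      case hH: (onth (c_gates C) h) => [H|]; last by move: hh; rewrite -onthTE hH.
      have sh := @slot_gate C n h 0 H hH isT; rewrite addn0 in sh.
      by apply: hsame sh si => //; lia.
    - rewrite -hv //; apply: hsame (slot_main C ok) si => //.
      by apply: leq_trans hN; lia.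
    - exact: zE.
  have := hviol (n.+1 + 3 * g) (n.+1 + 3 * g + 1) (n.+1 + 3 * g + 2).
  rewrite (wE _ _ h1 _ (slot_gate n hG (isT : 1 < 3))); last by lia.
  rewrite (wE _ _ h2 _ (slot_gate n hG (isT : 2 < 3))); last by lia.
  rewrite /violated !negb_or => /(_ _ _ _)/and3P[]; try by lia.
  move=> _ _; rewrite /gate_clash.
  have -> : n.+1 + 3 * g - n.+1 = g * 3 by lia.
  rewrite dvdn_mull // mulnK // hG addn1 addn2 !eqxx !andTb.
  have -> : n < n.+1 + 3 * g by lia.
  by rewrite negbK => /eqP.
have nN : n < N by lia.
have wE w i : i < N -> slot C n i = Some w -> wire_val x z vs w = v i.
  case: w => [p|j|h] hi si /=; have ok := slot_ok hC si.
  - rewrite -hv //; apply: hsame (slot_main C ok) si => //.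
    by apply: ltn_trans nN.
  - exact: zE.
  - rewrite gateE //.
    case hH: (onth (c_gates C) h) => [H|]; last by move: ok; rewrite /= -onthTE hH.
    have sh := @slot_gate C n h 0 H hH isT; rewrite addn0 in sh.
    rewrite /circuit_size /= in hN ok.
    by apply: hsame sh si => //; lia.
rewrite /circuit_eval (wE _ _ nN (slot_out C n)).
have := hviol n n n nN nN nN; rewrite /violated !eqxx /= !negb_or.
by case/and3P.
Qed.

(** * Definable predicates *)

(** A shallow embedding: predicates are written as ordinary propositions over a tuple of numbers,
    and the formula is found by following their syntax. The environment function turns the tuple
    into the list that formulas read. *)
Record context := Context {
  ctx_dom :> Type;
  ctx_env : ctx_dom -> seq nat;
  ctx_size : nat;
  ctx_envE : forall x, size (ctx_env x) = ctx_size
}.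

Lemma extend_size (G : context) (y : G * nat) :
  size (rcons (ctx_env y.1) y.2) = (ctx_size G).+1.
Proof. by rewrite size_rcons ctx_envE. Qed.

Definition extend (G : context) : context := Context (@extend_size G).

Definition definable_term (G : context) (t : G -> nat) : Prop :=
  exists u : term, forall x, teval (ctx_env x) u = t x.

Definition definable (G : context) (P : seq bool -> G -> Prop) : Prop :=
  exists f : form, forall w x, fsat w (ctx_env x) f <-> P w x.

(** A level outside the environment reads the default 0, but after an extension it could read the
    new variable; such levels are replaced by the constant 0. *)
Fixpoint restrict (d : nat) (u : term) : term :=
  match u with
  | TVar l => if l < d then TVar l else TCst 0
  | TCst n => TCst n
  | TAdd u1 u2 => TAdd (restrict d u1) (restrict d u2)
  | TMul u1 u2 => TMul (restrict d u1) (restrict d u2)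
  end.

Lemma teval_restrict e i u : teval (rcons e i) (restrict (size e) u) = teval e u.
Proof.
elim: u => //= [l|u1 -> u2 ->|u1 -> u2 ->] //; case: ltnP => hl /=.
  by rewrite nth_rcons hl.
by rewrite nth_default.
Qed.

Section Terms.

Variable G : context.
Implicit Types t : G -> nat.

Lemma dt_var : definable_term (G := extend G) (fun y => y.2).
Proof.
exists (TVar (ctx_size G)) => -[x i] /=.
by rewrite nth_rcons ctx_envE ltnn eqxx.
Qed.

Lemma dt_weaken t :
  definable_term t -> definable_term (G := extend G) (fun y => t y.1).
Proof.
move=> [u hu]; exists (restrict (ctx_size G) u) => -[x i] /=.
by rewrite -hu -(ctx_envE x) teval_restrict.
Qed.

Lemma dt_cst n : definable_term (fun _ : G => n).
Proof. by exists (TCst n). Qed.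

Lemma dt_add t1 t2 : definable_term t1 -> definable_term t2 ->
  definable_term (fun x => t1 x + t2 x).
Proof. by move=> [u1 h1] [u2 h2]; exists (TAdd u1 u2) => x /=; rewrite h1 h2. Qed.

Lemma dt_mul t1 t2 : definable_term t1 -> definable_term t2 ->
  definable_term (fun x => t1 x * t2 x).
Proof. by move=> [u1 h1] [u2 h2]; exists (TMul u1 u2) => x /=; rewrite h1 h2. Qed.

Lemma dt_succ t : definable_term t -> definable_term (fun x => (t x).+1).
Proof. by move=> [u h]; exists (TAdd (TCst 1) u) => x /=; rewrite h. Qed.

Lemma dt_exp t n : definable_term t -> definable_term (fun x => t x ^ n).
Proof.
move=> [u h]; exists (iter n (TMul u) (TCst 1)) => x.
by elim: n => //= n ->; rewrite h expnS.
Qed.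

End Terms.

Section Predicates.

Variable G : context.
Implicit Types (t : G -> nat) (P Q : seq bool -> G -> Prop).

Lemma df_ext P Q : (forall w x, P w x <-> Q w x) -> definable P -> definable Q.
Proof. by move=> PQ [f hf]; exists f => w x; rewrite hf PQ. Qed.

Lemma df_bit t : definable_term t -> definable (fun w x => nth false w (t x)).
Proof. by move=> [u h]; exists (FBit u) => w x /=; rewrite h. Qed.

Lemma df_lt t1 t2 : definable_term t1 -> definable_term t2 ->
  definable (fun _ x => t1 x < t2 x).
Proof. by move=> [u1 h1] [u2 h2]; exists (FLt u1 u2) => w x /=; rewrite h1 h2. Qed.

Lemma df_le t1 t2 : definable_term t1 -> definable_term t2 ->
  definable (fun _ x => t1 x <= t2 x).
Proof.
move=> h1 h2; apply: df_ext (df_lt h1 (dt_succ h2)) => w x.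
by rewrite ltnS.
Qed.

Lemma df_eq t1 t2 : definable_term t1 -> definable_term t2 ->
  definable (fun _ x => t1 x = t2 x).
Proof. by move=> [u1 h1] [u2 h2]; exists (FEq u1 u2) => w x /=; rewrite h1 h2. Qed.

Lemma df_bool (b : bool) : definable (fun _ (_ : G) => b).
Proof. by exists (FLt (TCst 0) (TCst b)) => w x /=; case: b. Qed.

Lemma df_not P : definable P -> definable (fun w x => ~ P w x).
Proof. by move=> [f h]; exists (FNot f) => w x /=; rewrite h. Qed.

Lemma df_and P Q : definable P -> definable Q ->
  definable (fun w x => P w x /\ Q w x).
Proof. by move=> [f h] [g h']; exists (FAnd f g) => w x /=; rewrite h h'. Qed.

Lemma df_or P Q : definable P -> definable Q ->
  definable (fun w x => P w x \/ Q w x).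
Proof. by move=> [f h] [g h']; exists (FOr f g) => w x /=; rewrite h h'. Qed.

Lemma df_imp P Q : definable P -> definable Q ->
  definable (fun w x => P w x -> Q w x).
Proof. by move=> [f h] [g h']; exists (FImp f g) => w x /=; rewrite h h'. Qed.

Lemma df_iff P Q : definable P -> definable Q ->
  definable (fun w x => P w x <-> Q w x).
Proof. by move=> hP hQ; apply: df_and; apply: df_imp. Qed.

Lemma df_all t (P : seq bool -> G -> nat -> Prop) : definable_term t ->
  definable (G := extend G) (fun w y => P w y.1 y.2) ->
  definable (fun w x => forall i, i < t x -> P w x i).
Proof.
move=> [u hu] [f hf]; exists (FAll u f) => w x /=; rewrite hu.
by split=> H i /H; rewrite (hf w (x, i)).
Qed.

Lemma df_ex t (P : seq bool -> G -> nat -> Prop) : definable_term t ->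
  definable (G := extend G) (fun w y => P w y.1 y.2) ->
  definable (fun w x => exists i, i < t x /\ P w x i).
Proof.
move=> [u hu] [f hf]; exists (FEx u f) => w x /=; rewrite hu.
by split=> -[i [hi H]]; exists i; split=> //; apply/(hf w (x, i)).
Qed.

(** A quantifier over states, symbols or tapes becomes a finite conjunction; in this way a fixed
    machine is built into a formula. *)
Lemma df_fin_all (I : finType) (P : I -> seq bool -> G -> Prop) :
  (forall i, definable (P i)) -> definable (fun w x => forall i, P i w x).
Proof.
move=> hP; suff /(_ (enum I)) : forall s : seq I,
    definable (fun w x => forall i, i \in s -> P i w x).
  apply: df_ext => w x; split=> H i; last by move=> _; apply: H.
  by apply: H; rewrite mem_enum.
elim=> [|i s IH]; first by apply: df_ext (df_bool true).
apply: df_ext (df_and (hP i) IH) => w x; split=> [[H1 H2] j|H].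
  by rewrite inE => /orP[/eqP->|/H2].
by split=> [|j hj]; apply: H; rewrite inE ?eqxx ?hj ?orbT.
Qed.

Lemma df_fin_ex (I : finType) (P : I -> seq bool -> G -> Prop) :
  (forall i, definable (P i)) -> definable (fun w x => exists i, P i w x).
Proof.
move=> hP; suff /(_ (enum I)) : forall s : seq I,
    definable (fun w x => exists i, i \in s /\ P i w x).
  apply: df_ext => w x; split=> [[i [_ H]]|[i H]]; exists i => //.
  by rewrite mem_enum.
elim=> [|i s IH]; first by apply: df_ext (df_bool false) => w x; split=> // -[? []].
apply: df_ext (df_or (hP i) IH) => w x; split=> [[H|[j [hj H]]]|[j []]].
- by exists i; rewrite inE eqxx.
- by exists j; rewrite inE hj orbT.
- by rewrite inE => /orP[/eqP->|hj] H; [left|right; exists j].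
Qed.

End Predicates.

Definition length_context : context :=
  @Context nat (fun n => [:: n]) 1 (fun=> erefl).

Lemma dt_length : definable_term (fun n : length_context => n).
Proof. by exists (TVar 0). Qed.

Lemma definable_decidable (P : seq bool -> length_context -> Prop) :
  definable P ->
  exists R, poly_decidable R /\ forall w, R w <-> P w (size w).
Proof.
move=> [f hf]; exists (fun w => fval w [:: size w] f); split.
  exact: form_poly_decidable.
by move=> w; rewrite -(hf w (size w)); split=> /fsatP.
Qed.

(** Weakening comes last. It replaces the newest variable by a dummy 0, which is correct when the
    term does not depend on that variable; otherwise the refinement fails. *)
Ltac dterm :=
  cbn beta;
  first
  [ eassumption
  | lazymatch goal with
    | |- @definable_term _ (fun _ => _.+1) => apply: dt_succ; dterm
    | |- @definable_term _ (fun _ => _ + _) => apply: dt_add; dterm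
    | |- @definable_term _ (fun _ => _ * _) => apply: dt_mul; dterm
    | |- @definable_term _ (fun _ => _ ^ _) => apply: dt_exp; dterm
    end
  | apply: dt_cst
  | exact: dt_var
  | exact: dt_length
  | lazymatch goal with
    | |- @definable_term (extend ?G) ?t =>
        let t' := eval cbn beta iota in
          (fun (x : ctx_dom G) => t (x, 0)) in
        refine (@dt_weaken G t' _); dterm
    end ].

Ltac dform :=
  cbn beta;
  lazymatch goal with
  | |- definable (fun _ _ => _ /\ _) => apply: df_and; dform
  | |- definable (fun _ _ => _ \/ _) => apply: df_or; dform
  | |- definable (fun _ _ => ~ _) => apply: df_not; dform
  | |- definable (fun _ _ => _ <-> _) => apply: df_iff; dform
  | |- definable (fun _ _ => exists i, is_true (leq (S i) _) /\ _) =>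
      apply: df_ex; [dterm | dform]
  | |- definable (fun _ _ => forall i : nat, is_true (leq (S i) _) -> _) =>
      apply: df_all; [dterm | dform]
  | |- definable (fun _ _ => exists i : _, _) =>
      apply: df_fin_ex => ?; dform
  | |- definable (fun _ _ => is_true (leq (S _) _)) => apply: df_lt; dterm
  | |- definable (fun _ _ => is_true (leq _ _)) => apply: df_le; dterm
  | |- definable (fun _ _ => is_true (nth _ _ _)) => apply: df_bit; dterm
  | |- definable (fun _ _ => is_true _) => apply: df_bool
  | |- definable (fun _ _ => @eq nat _ _) => apply: df_eq; dterm
  | |- definable (fun _ _ => forall _ : _, _) =>
      first [apply: df_imp | apply: df_fin_all => ?]; dform
  | |- _ => idtac
  end.

(** * Pairs and queries *)

Definition is_pair (w : seq bool) (n : nat) : Prop :=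
  (forall i, i < n -> (nth false w (2 * i) <-> nth false w (2 * i + 1))) /\
  ~ nth false w (2 * n) /\ nth false w (2 * n + 1).

Definition digit (b X t : nat) : nat := (X %/ b ^ t) %% b.

(* Each digit of X in base b is written in unary on b bits, so that the position
   of a digit is a polynomial in b. *)
Definition codes_number (d : nat) (w : seq bool) (s o b X : nat) : Prop :=
  forall t : 'I_d, forall g, g < b -> forall h, h < X.+1 ->
  forall r, r < b ^ t -> X = (h * b + g) * b ^ t + r ->
  forall p, p < b -> (nth false w (s * (t * b + p) + o) <-> p < g).

Definition query_size (d b : nat) : nat := 3 * (d * b) + 3.

Definition query (d b i j l : nat) (a1 a2 a3 : bool) : seq bool :=
  mkseq (fun p => p %% b < digit b (nth 0 [:: i; j; l] (p %/ (d * b)))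
                                   ((p %/ b) %% d)) (3 * (d * b)) ++
  [:: a1; a2; a3].

(** The stride [s] is 1 for a query inside a witness, and 2 for a query that is the first component
    of a pair, whose bits are doubled. *)
Definition codes_query (d : nat) (w : seq bool) (s o b i j l : nat)
    (a1 a2 a3 : Prop) : Prop :=
  codes_number d w s o b i /\
  codes_number d w s (o + s * (d * b)) b j /\
  codes_number d w s (o + s * (2 * (d * b))) b l /\
  (nth false w (s * (3 * (d * b)) + o) <-> a1) /\
  (nth false w (s * (3 * (d * b) + 1) + o) <-> a2) /\
  (nth false w (s * (3 * (d * b) + 2) + o) <-> a3).

Section Definability.

Variable G : context.
Implicit Types (t s o b i j l : G -> nat) (P : seq bool -> G -> Prop).

Lemma df_is_pair t : definable_term t -> definable (fun w x => is_pair w (t x)).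
Proof. by move=> ht; rewrite /is_pair; dform. Qed.

Lemma df_codes_number d s o b i : definable_term s -> definable_term o ->
  definable_term b -> definable_term i ->
  definable (fun w x => codes_number d w (s x) (o x) (b x) (i x)).
Proof.
move=> hs ho hb hi; rewrite /codes_number; apply: df_fin_all => t; dform.
Qed.

Lemma df_codes_query d s o b i j l P1 P2 P3 :
  definable_term s -> definable_term o -> definable_term b ->
  definable_term i -> definable_term j -> definable_term l ->
  definable P1 -> definable P2 -> definable P3 ->
  definable (fun w x => codes_query d w (s x) (o x) (b x) (i x) (j x) (l x)
                          (P1 w x) (P2 w x) (P3 w x)).
Proof.
move=> hs ho hb hi hj hl h1 h2 h3; rewrite /codes_query; dform=> //;
  apply: df_codes_number => //; dterm.
Qed.

End Definability.

(** * The hard language *)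

Definition table_index (V i j l : nat) (a1 a2 a3 : nat) : nat :=
  ((i * V + j) * V + l) * 8 + (a1 * 4 + a2 * 2 + a3).

Section Hard.

Variable k : nat.

(** The constraint table of [D] has 8V^3 bits with V of order b^k; one more factor b absorbs the
    constants. *)
Definition len_exp : nat := 3 * k + 1.
(** The slots of [C n] are at most n + 1 + 3n^k in number, with n^k = b^([len_exp] k); two more
    digits absorb the constant 5. *)
Definition num_digits : nat := len_exp * k + 2.
Notation e := len_exp.
Notation d := num_digits.

Definition bit_holds (w : seq bool) (p a : nat) : Prop := nth false w p <-> a = 1.

(* The bits of y are the values v_0, .., v_(N-1), and then, for all i, j, l < N,
   a certificate of V bits that the query (i, j, l, v_i, v_j, v_l) satisfies the
   constraints listed in x. *)
Definition hard_body (w : seq bool) (n b V N : nat) : Prop :=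
  (forall i, i < n ->
     (nth false w (2 * i) <-> nth false w (2 * n + 2 + i))) /\
  forall i, i < N -> forall j, j < N -> forall l, l < N ->
    codes_query d w 1 (2 * n + 2 + (N + ((i * N + j) * N + l) * V)) b i j l
      (nth false w (2 * n + 2 + i)) (nth false w (2 * n + 2 + j))
      (nth false w (2 * n + 2 + l)) /\
    forall i', i' < V -> forall j', j' < V -> forall l', l' < V ->
    forall a1, a1 < 2 -> forall a2, a2 < 2 -> forall a3, a3 < 2 ->
      bit_holds w (i' + (2 * n + 2 + (N + ((i * N + j) * N + l) * V))) a1 ->
      bit_holds w (j' + (2 * n + 2 + (N + ((i * N + j) * N + l) * V))) a2 ->
      bit_holds w (l' + (2 * n + 2 + (N + ((i * N + j) * N + l) * V))) a3 ->
      ~ nth false w (2 * table_index V i' j' l' a1 a2 a3).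

(** Terms have no roots or division, so the parameters are guessed, below the total length since
    quantifiers are bounded. The length n determines b, hence V and N. *)
Definition hard_check (w : seq bool) (m : nat) : Prop :=
  exists n, n < m /\ (is_pair w n /\ exists b, b < m /\ (0 < b /\ n = b ^ e /\
  exists V, V < m /\ (V = (query_size d b).+1 + 3 * query_size d b ^ k /\
  exists N, N < m /\ (N = b ^ d /\ hard_body w n b V N)))).

Lemma df_hard_check :
  definable (fun w (m : length_context) => hard_check w m).
Proof.
rewrite /hard_check /query_size; dform; first by apply: df_is_pair; dterm.
rewrite /hard_body /table_index /bit_holds; dform.
by apply: df_codes_query; by [dterm|dform].
Qed.

End Hard.

(** * Decoding of pairs and queries, and the meaning of the hard language *)

Lemma size_pair_code x y : size (pair_code x y) = 2 * size x + 2 + size y.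
Proof.
rewrite /pair_code size_cat /= size_flatten /shape -map_comp.
have -> : sumn [seq (size \o (fun b : bool => [:: b; b])) i | i <- x] = 2 * size x.
  by elim: x => //= b x ->; lia.
by lia.
Qed.

Lemma nth_pair_code0 x y i : i < size x ->
  nth false (pair_code x y) (2 * i) = nth false x i.
Proof.
rewrite /pair_code; elim: x i => // b x IH [|i] // hi.
by rewrite [RHS]/= -IH // (_ : 2 * i.+1 = (2 * i).+2) //; lia.
Qed.

Lemma nth_pair_code1 x y i : i < size x ->
  nth false (pair_code x y) (2 * i + 1) = nth false x i.
Proof.
rewrite /pair_code; elim: x i => // b x IH [|i] // hi.
by rewrite [RHS]/= -IH // (_ : 2 * i.+1 + 1 = (2 * i + 1).+2) //; lia.
Qed.

Lemma nth_pair_code2 x y p :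
  nth false (pair_code x y) (2 * size x + p) = nth false [:: false, true & y] p.
Proof.
rewrite /pair_code; elim: x p => // b x IH p.
by rewrite -IH [size _]/= (_ : 2 * (size x).+1 + p = (2 * size x + p).+2) //; lia.
Qed.

Lemma nth_pair_codeR x y p :
  nth false (pair_code x y) (2 * size x + 2 + p) = nth false y p.
Proof. by rewrite -addnA nth_pair_code2. Qed.

(** The separator 01 marks the end of the first component: a smaller n would find two different bits
    in a doubled pair, and a larger one would require the separator to be doubled. *)
Lemma is_pairE x y n : is_pair (pair_code x y) n <-> n = size x.
Proof.
split=> [[h1 [h2 h3]]|->].
  have [hn|hn|//] := ltngtP n (size x).
    by rewrite nth_pair_code1 // in h3; rewrite nth_pair_code0 // in h2.
  have := h1 _ hn; rewrite nth_pair_code2 -[2 * size x]addn0 nth_pair_code2 /=.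
  by case=> _ /(_ isT).
split=> [i hi|]; first by rewrite nth_pair_code0 ?nth_pair_code1.
by rewrite nth_pair_code2 -[2 * size x]addn0 nth_pair_code2.
Qed.

(** Without division in terms, digit t is the g of the decomposition (h b + g) b^t + r with r below
    b^t, which exists and determines g. *)
Lemma codes_numberE d w s o b X : 0 < b ->
  codes_number d w s o b X <->
  forall t p, t < d -> p < b ->
    nth false w (s * (t * b + p) + o) = (p < digit b X t).
Proof.
move=> b0; split=> [H t p td pb|H t g gb h _ r rb XE p pb].
  have [||||h1 h2] := H (Ordinal td) (digit b X t) _ (X %/ b ^ t %/ b) _
    (X %% b ^ t) _ _ p pb; last by apply/idP/idP.
  - by rewrite ltn_mod.
  - by rewrite ltnS; apply: leq_trans (leq_div _ _) (leq_div _ _).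
  - by rewrite ltn_mod expn_gt0 b0.
  - by rewrite -!divn_eq.
rewrite H // (_ : digit b X t = g) //.
rewrite /digit XE divnMDl ?expn_gt0 ?b0 // (divn_small rb) addn0.
by rewrite modnMDl modn_small.
Qed.

Lemma size_query d b i j l a1 a2 a3 :
  size (query d b i j l a1 a2 a3) = query_size d b.
Proof. by rewrite /query size_cat size_mkseq. Qed.

Lemma nth_query d b i j l a1 a2 a3 s t p : s < 3 -> t < d -> p < b ->
  nth false (query d b i j l a1 a2 a3) (s * (d * b) + (t * b + p)) =
  (p < digit b (nth 0 [:: i; j; l] s) t).
Proof.
move=> s3 td pb.
have h : t * b + p < d * b by nia.
have h3 : s * (d * b) + (t * b + p) < 3 * (d * b) by nia.
rewrite /query nth_cat size_mkseq h3 nth_mkseq //.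
rewrite divnMDl ?(divn_small h) ?addn0; last by lia.
rewrite mulnA addnA -mulnDl modnMDl (modn_small pb).
rewrite divnMDl ?(divn_small pb) ?addn0; last by lia.
by rewrite modnMDl (modn_small td).
Qed.

Lemma nth_query_bit d b i j l a1 a2 a3 s : s < 3 ->
  nth false (query d b i j l a1 a2 a3) (3 * (d * b) + s) =
  nth false [:: a1; a2; a3] s.
Proof.
move=> s3; rewrite /query nth_cat size_mkseq ltnNge leq_addr /=.
by rewrite addnC addnK.
Qed.

Lemma codes_queryE d w s o b i j l (a1 a2 a3 : bool) : 0 < b ->
  codes_query d w s o b i j l a1 a2 a3 <->
  forall p, p < query_size d b ->
    nth false w (s * p + o) = nth false (query d b i j l a1 a2 a3) p.
Proof.
move=> b0; have shift u t p :
    s * (t * b + p) + (o + s * (u * (d * b))) = s * (u * (d * b) + (t * b + p)) + o.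
  by lia.
split=> [[hi [hj [hl [h1 [h2 h3]]]]] p hp|H].
  have num o' X : codes_number d w s o' b X -> forall t p', t < d -> p' < b ->
      nth false w (s * (t * b + p') + o') = (p' < digit b X t).
    by move/codes_numberE; apply.
  have [hp3|hp3] := ltnP p (3 * (d * b)).
    set u := p %/ (d * b); set t := (p %% (d * b)) %/ b.
    have db0 : 0 < d * b by lia.
    have u3 : u < 3 by rewrite ltn_divLR.
    have td : t < d by rewrite ltn_divLR // ltn_mod.
    have pE : p = u * (d * b) + (t * b + p %% (d * b) %% b).
      by rewrite -divn_eq -divn_eq.
    have pb : p %% (d * b) %% b < b by rewrite ltn_mod.
    move: pb pE; move: (p %% _ %% b) => p' pb ->; rewrite nth_query // -shift.
    case: u u3 => [|[|[|]]] // _.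
    - by rewrite mul0n muln0 addn0 (num _ _ hi).
    - by rewrite mul1n (num _ _ hj).
    - by rewrite (num _ _ hl).
  have -> : p = 3 * (d * b) + (p - 3 * (d * b)) by lia.
  have : p - 3 * (d * b) < 3 by move: hp; rewrite /query_size; lia.
  case: (p - _) => [|[|[|]]] // _; rewrite nth_query_bit //; apply/idP/idP;
    rewrite ?addn0; by [move/h1|move/h2|move/h3].
have qs u t p : u < 3 -> t < d -> p < b ->
    nth false w (s * (t * b + p) + (o + s * (u * (d * b)))) =
    (p < digit b (nth 0 [:: i; j; l] u) t).
  move=> u3 td pb; rewrite shift H ?nth_query //; rewrite /query_size.
  have : t * b + p < d * b by nia.
  by nia.
have qb u : u < 3 -> nth false w (s * (3 * (d * b) + u) + o) =
    nth false [:: a1; a2; a3] u.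
  by move=> u3; rewrite H ?nth_query_bit // /query_size; lia.
split; first by apply/codes_numberE => // t p td pb; rewrite -(qs 0) // mul0n muln0 addn0.
split; first by apply/codes_numberE => // t p td pb; rewrite -(qs 1) // mul1n.
split; first by apply/codes_numberE => // t p td pb; rewrite -(qs 2).
by rewrite (qb 1) // (qb 2) // -[3 * (d * b)]addn0 (qb 0).
Qed.

Lemma digits_inj b d X Y : X < b ^ d -> Y < b ^ d ->
  (forall t, t < d -> digit b X t = digit b Y t) -> X = Y.
Proof.
elim: d X Y => [|d IH] X Y; first by rewrite expn0; lia.
case: (posnP b) => [->|b0]; first by rewrite exp0n.
move=> hX hY H; rewrite (divn_eq X b) (divn_eq Y b).
have -> : X %% b = Y %% b by have := H 0 isT; rewrite /digit expn0 !divn1.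
congr (_ * b + _); apply: IH; rewrite ?ltn_divLR // -?expnSr // => t td.
by have := H t.+1 td; rewrite /digit expnS !divnMA.
Qed.

Lemma query_inj d b i j l a1 a2 a3 i' j' l' a1' a2' a3' : 0 < b ->
  i < b ^ d -> j < b ^ d -> l < b ^ d -> i' < b ^ d -> j' < b ^ d -> l' < b ^ d ->
  query d b i j l a1 a2 a3 = query d b i' j' l' a1' a2' a3' ->
  [/\ i = i', j = j', l = l' & [/\ a1 = a1', a2 = a2' & a3 = a3']].
Proof.
move=> b0 hi hj hl hi' hj' hl' E.
have bitE s : s < 3 -> nth false [:: a1; a2; a3] s = nth false [:: a1'; a2'; a3'] s.
  by move=> s3; rewrite -(nth_query_bit d b i j l) // E nth_query_bit.
have digE s t : s < 3 -> t < d ->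
    digit b (nth 0 [:: i; j; l] s) t = digit b (nth 0 [:: i'; j'; l'] s) t.
  move=> s3 td.
  have lt X : digit b X t < b by rewrite ltn_mod.
  have ltE p : p < b -> (p < digit b (nth 0 [:: i; j; l] s) t) =
      (p < digit b (nth 0 [:: i'; j'; l'] s) t).
    move=> pb; have := @nth_query d b i j l a1 a2 a3 s t p s3 td pb.
    by rewrite E nth_query.
  move: (lt (nth 0 [:: i; j; l] s)) (lt (nth 0 [:: i'; j'; l'] s)) ltE.
  move: (digit _ _ _) (digit _ _ _) => g g' hg hg' ltE.
  by have := ltE _ hg; have := ltE _ hg'; rewrite !ltnn; lia.
split; last by split; [have := bitE 0 isT|have := bitE 1 isT|have := bitE 2 isT].
- by apply: (digits_inj hi hi') => t td; have := digE 0 t isT td.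
- by apply: (digits_inj hj hj') => t td; have := digE 1 t isT td.
- by apply: (digits_inj hl hl') => t td; have := digE 2 t isT td.
Qed.

Lemma NP_definable c (P : seq bool -> length_context -> Prop) : definable P ->
  NP (fun x => exists y, size y <= poly_bound c (size x) /\
                 P (pair_code x y) (size (pair_code x y))).
Proof.
move=> /definable_decidable[R [hR RP]]; exists R, c; split=> // x.
by split=> -[y [hy h]]; exists y; split=> //; apply/RP.
Qed.

Definition cert_size (k b : nat) : nat :=
  (query_size (num_digits k) b).+1 + 3 * query_size (num_digits k) b ^ k.

Definition hard_witness_size (k b : nat) : nat :=
  b ^ num_digits k + (b ^ num_digits k) ^ 3 * cert_size k b.

Definition hard_language (k c : nat) : language := fun x =>
  exists y, size y <= poly_bound c (size x) /\
    hard_check k (pair_code x y) (size (pair_code x y)).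

Lemma NP_hard_language k c : NP (hard_language k c).
Proof. exact/NP_definable/df_hard_check. Qed.

Lemma pbounded_hard_witness_size k : pbounded (hard_witness_size k).
Proof.
have hq : pbounded (fun b => query_size (num_digits k) b).
  rewrite /query_size; apply: pbounded_add (pbounded_cst _).
  by do !apply: pbounded_mul; do ?[exact: pbounded_cst | exact: pbounded_id].
have hN : pbounded (fun b => b ^ num_digits k) by exact/pbounded_exp/pbounded_id.
apply: pbounded_add => //; apply: pbounded_mul; first exact: pbounded_exp.
apply: pbounded_add; last exact/pbounded_mul/pbounded_exp/hq/pbounded_cst.
apply: (@pbounded_le _ (fun b => query_size (num_digits k) b + 1)).
  by move=> n; rewrite addn1.
exact: pbounded_add (pbounded_cst _).
Qed.

Section HardLanguage.

Variables (k c b : nat) (x : seq bool).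
Notation e := (len_exp k).
Notation d := (num_digits k).
Notation N := (b ^ d).
Notation V := (cert_size k b).
Hypotheses (b0 : 0 < b) (hx : size x = b ^ e).
Hypothesis hc : hard_witness_size k b <= poly_bound c (size x).

Hypothesis htab : V ^ 3 * 8 <= size x.

Lemma table_index_lt i j l (a1 a2 a3 : bool) : i < V -> j < V -> l < V ->
  table_index V i j l a1 a2 a3 < size x.
Proof.
move=> hi hj hl; apply: leq_trans htab; rewrite /table_index.
have : a1 * 4 + a2 * 2 + a3 < 8 by case: a1; case: a2; case: a3.
move: (_ + a3) => a ha; move: V hi hj hl => V' hi hj hl.
have h1 : i * V' + j < V' * V' by nia.
have h2 : (i * V' + j) * V' + l < V' ^ 3 by rewrite !expnS expn0; nia.
by nia.
Qed.

(** When x lists the constraints of a circuit [D], such a [u] assigns values to the slots of [D]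
    with the query as main input: it proves that [D] rejects the query. *)
Definition certifies (v : nat -> bool) (i j l : nat) (u : nat -> bool) : Prop :=
  (forall p, p < query_size d b ->
     u p = nth false (query d b i j l (v i) (v j) (v l)) p) /\
  forall i' j' l', i' < V -> j' < V -> l' < V ->
    ~~ nth false x (table_index V i' j' l' (u i') (u j') (u l')).

Definition hard_witness (v : nat -> bool) (u : nat -> nat -> nat -> nat -> bool) :
    seq bool :=
  mkseq (fun p => if p < N then v p else
    let r := (p - N) %/ V in
    u (r %/ N %/ N) (r %/ N %% N) (r %% N) ((p - N) %% V))
  (hard_witness_size k b).

Lemma N_gt0 : 0 < N.
Proof. by rewrite expn_gt0 b0. Qed.

Lemma cert_index_lt i j l p : i < N -> j < N -> l < N -> p < V ->
  N + ((i * N + j) * N + l) * V + p < hard_witness_size k b.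
Proof.
move=> hi hj hl hp; rewrite /hard_witness_size -addnA ltn_add2l.
move: N V hi hj hl hp => N' V' hi hj hl hp.
have h1 : i * N' + j < N' * N' by nia.
have h2 : (i * N' + j) * N' + l < N' ^ 3 by rewrite !expnS expn0; nia.
by nia.
Qed.

Lemma nth_hard_witness v u i : i < N -> nth false (hard_witness v u) i = v i.
Proof.
move=> hi; rewrite nth_mkseq ?hi //.
by apply: leq_trans hi _; rewrite /hard_witness_size leq_addr.
Qed.

Lemma nth_hard_cert v u i j l p : i < N -> j < N -> l < N -> p < V ->
  nth false (hard_witness v u) (N + ((i * N + j) * N + l) * V + p) = u i j l p.
Proof.
move=> hi hj hl hp; rewrite nth_mkseq; last exact: cert_index_lt.
have N0 := N_gt0; have V0 : 0 < V by [].
rewrite -addnA ltnNge leq_addr /= addKn.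
rewrite (divnMDl _ _ V0) (divn_small hp) addn0 (modnMDl _ p V) (modn_small hp).
rewrite (divnMDl _ _ N0) (divn_small hl) addn0 (modnMDl _ l N) (modn_small hl).
by rewrite (divnMDl _ _ N0) (divn_small hj) addn0 (modnMDl _ j N) (modn_small hj).
Qed.

Lemma hard_languageE : hard_language k c x <->
  exists v, (forall i, i < size x -> v i = nth false x i) /\
    forall i j l, i < N -> j < N -> l < N -> exists u, certifies v i j l u.
Proof.
split=> [[y [_ [n [_ [/is_pairE-> [b' [_ [b'0 [xE [V' [_ [VE [N' [_ [NE]]]]]]]]]]]]]]]|].
  (* The guessed base is the right one because raising to the positive power [len_exp k] is
     injective. *)
  have bE : b' = b.
    by apply/eqP; rewrite -(@eqn_exp2r _ _ e) -?xE ?hx // /len_exp addn1.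
  rewrite bE in VE NE; rewrite VE NE bE -/(cert_size k b) => -[hv hu].
  pose v i := nth false y i.
  have vE i : nth false (pair_code x y) (2 * size x + 2 + i) = v i.
    exact: nth_pair_codeR.
  exists v; split=> [i hi|i j l hi hj hl].
    rewrite -vE -(nth_pair_code0 y hi).
    by apply/idP/idP => /(hv i hi).
  have [] := hu i hi j hj l hl; set o := _ + (_ + _ * V).
  rewrite !vE => /(codes_queryE _ _ _ _ _ _ _ _ _ _ b0) hq hcert.
  exists (fun p => nth false (pair_code x y) (p + o)); split=> [p hp|i' j' l' hi' hj' hl'].
    by rewrite -hq // mul1n.
  rewrite /=; set a1 := nth _ _ (i' + _); set a2 := nth _ _ (j' + _); set a3 := nth _ _ (l' + _).
  have ltb (a : bool) : a < 2 by case: a.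
  have hb p : bit_holds (pair_code x y) p (nth false (pair_code x y) p).
    by rewrite /bit_holds; case: nth.
  have := hcert i' hi' j' hj' l' hl' a1 (ltb _) a2 (ltb _) a3 (ltb _)
     (hb _) (hb _) (hb _).
  by rewrite nth_pair_code0 ?table_index_lt // => /negP.
case=> v [hv hu].
(* One string has to contain the certificates of all triples, hence a choice function. *)
pose u i j l := epsilon (inhabits xpred0) (certifies v i j l).
have {}hu i j l : i < N -> j < N -> l < N -> certifies v i j l (u i j l).
  by move=> hi hj hl; apply: epsilon_spec; exact: hu.
pose y := hard_witness v u; exists y.
have sy : size y = hard_witness_size k b by rewrite size_mkseq.
split; first by rewrite sy.
have N0 := N_gt0.
have VNw : V <= hard_witness_size k b.
  rewrite /hard_witness_size; apply: leq_trans (leq_addl _ _).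
  by rewrite leq_pmull // expn_gt0 N0.
have NNw : N <= hard_witness_size k b by exact: leq_addr.
have bx : b <= size x by rewrite hx /len_exp addn1 -[X in X <= _]expn1 leq_pexp2l.
exists (size x); rewrite size_pair_code sy; split; first by lia.
split; first exact/is_pairE.
exists b; split; first by lia.
split=> //; split=> //; exists V; split; first by lia.
split=> //; exists N; split; first by lia.
have vE i : i < N -> nth false (pair_code x y) (2 * size x + 2 + i) = v i.
  by move=> hi; rewrite nth_pair_codeR nth_hard_witness.
have xN : size x <= N.
  by rewrite hx leq_pexp2l // /num_digits /len_exp; move: hc; nia.
split=> //; split=> [i hi|i hi j hj l hl].
  by rewrite nth_pair_code0 // vE ?hv //; exact: leq_trans xN.
have [hq hcert] := hu i j l hi hj hl.
have uE p : p < V -> nth false (pair_code x y)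
    (p + (2 * size x + 2 + (N + ((i * N + j) * N + l) * V))) = u i j l p.
  by move=> hp; rewrite addnC -addnA nth_pair_codeR nth_hard_cert.
split.
  rewrite !vE //; apply/codes_queryE => // p hp.
  by rewrite mul1n uE ?hq // /cert_size; lia.
move=> i' hi' j' hj' l' hl' a1 ha1 a2 ha2 a3 ha3.
rewrite /bit_holds !uE // => h1 h2 h3; apply/negP.
have bitE (a : bool) (m : nat) : m < 2 -> (a <-> m = 1) -> m = a.
  by case: a => [|]; case: m => [|[|m]] // _ []; [move/(_ isT)|move=> _ /(_ erefl)].
rewrite (bitE _ _ ha1 h1) (bitE _ _ ha2 h2) (bitE _ _ ha3 h3).
by rewrite nth_pair_code0 ?table_index_lt ?hcert.
Qed.

End HardLanguage.

(** * Tableaux of Turing machine computations *)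

Section Tableau.

Variable M : tm.

(* A fact about a configuration: its state, or the symbol in a given position
   of the right ([true]) or left ([false]) part of a tape. *)
Definition fact : finType :=
  (tm_state M + ('I_(tm_tapes M).+1 * bool * symbol (tm_work M)))%type.

Definition fstate (q : tm_state M) : fact := inl q.

Definition fcell (i : 'I_(tm_tapes M).+1) (rt : bool)
    (s : symbol (tm_work M)) : fact := inr (i, rt, s).

(* [H t p f] asserts the fact [f] for position [p] at time [t]; for a state the
   position is irrelevant. *)
Implicit Types H : nat -> nat -> fact -> Prop.

Definition start_fact (n p : nat) (f : fact) : Prop :=
  match f with
  | inl q => q == tm_start M
  | inr (i, rt, s) =>
      if rt && (i == ord0) then
        (s == Some (inl true) /\ p < n) \/ (s == None /\ n <= p)
      else s == None
  end.

(** Positions are relative to the head, so a move shifts both parts of the tape and no head position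
    is recorded. The predecessor p' is quantified because terms have no subtraction. *)
Definition moved_fact H (t p : nat) (i : 'I_(tm_tapes M).+1) (rt : bool)
    (s wr : symbol (tm_work M)) (mv : move) : Prop :=
  match mv, rt with
  | MoveL, true =>
      (p = 0 /\ H t 0 (fcell i false s)) \/ (p = 1 /\ wr == s) \/
      exists p', p' < p /\ (p = p'.+1 /\ 0 < p' /\ H t p' (fcell i true s))
  | MoveL, false => H t p.+1 (fcell i false s)
  | MoveR, true => H t p.+1 (fcell i true s)
  | MoveR, false =>
      (p = 0 /\ wr == s) \/
      exists p', p' < p /\ (p = p'.+1 /\ H t p' (fcell i false s))
  | Stay, true => (p = 0 /\ wr == s) \/ (0 < p /\ H t p (fcell i true s))
  | Stay, false => H t p (fcell i false s)
  end.

Definition next_fact H (t p : nat) (f : fact) (q : tm_state M)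
    (a : {ffun 'I_(tm_tapes M).+1 -> symbol (tm_work M)}) : Prop :=
  if tm_halt q then H t p f else
  match f with
  | inl q' => (tm_trans q a).1 == q'
  | inr (i, rt, s) =>
      moved_fact H t p i rt s ((tm_trans q a).2 i).1 ((tm_trans q a).2 i).2
  end.

(** Only asserted facts are constrained: each needs a justification one step earlier. True facts may
    be left out, so a table of bounded width can be cut off without boundary conditions. *)
Definition tableau H (n T B : nat) : Prop :=
  (forall f : fact, forall p, p < B -> H 0 p f -> start_fact n p f) /\
  forall f : fact, forall t, t < T -> forall p, p < B -> H t.+1 p f ->
    exists q : tm_state M,
    exists a : {ffun 'I_(tm_tapes M).+1 -> symbol (tm_work M)},
      H t 0 (fstate q) /\ (forall i, H t 0 (fcell i true (a i))) /\
      next_fact H t p f q a.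

Definition run (n t : nat) : config M :=
  iter t (@tm_step M) (tm_init M (nseq n true)).

Definition fact_holds (n t p : nat) (f : fact) : Prop :=
  match f with
  | inl q => cf_state (run n t) == q
  | inr (i, rt, s) =>
      nth None (if rt then (cf_tape (run n t) i).2
                else (cf_tape (run n t) i).1) p == s
  end.

Lemma fact_holds_start n p f : fact_holds n 0 p f <-> start_fact n p f.
Proof.
case: f => [q|[[i r] s]] /=; first by rewrite eq_sym.
rewrite ffunE; have [i0|i0] := eqVneq i ord0; last first.
  by rewrite andbF; case: r; rewrite nth_nil eq_sym.
case: r => /=; last by rewrite nth_nil eq_sym.
have [hp|hp] := ltnP p n.
  rewrite (nth_map true) ?size_nseq // nth_nseq hp eq_sym.
  by split=> [|[[]|[]]] //; left.
rewrite nth_default ?size_map ?size_nseq // eq_sym.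
by split=> [|[[]|[]]] //; right.
Qed.

Lemma nth_behead_write (wr : symbol (tm_work M)) (l : seq (symbol (tm_work M))) p :
  nth None (wr :: behead l) p = if p == 0 then wr else nth None l p.
Proof. by case: p => //= p; rewrite nth_behead. Qed.

Lemma fact_holds_next n t p f :
  fact_holds n t.+1 p f <->
  next_fact (fact_holds n) t p f (cf_state (run n t))
    [ffun i => tape_read (cf_tape (run n t) i)].
Proof.
rewrite /fact_holds /next_fact /run iterS -/(run n t); set c := run n t.
rewrite /tm_step; case: ifP => [hh|_]; first by case: f.
case: (tm_trans _ _) => q act; case: f => [q'|[[i r] s]] //=.
rewrite ffunE; case: (act i) => wr mv /=; set tp := cf_tape c i.
case: mv; case: r => /=.
- case: p => [|[|p]] /=.
  + rewrite nth0; split; first by left.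
    by case=> [[]|[[]|[p' []]]].
  + split; first by right; left.
    by case=> [[]|[[]|[p' [_ [[<-]]]]]] // [].
  + rewrite nth_behead; split; last by case=> [[]|[[]|[p' [_ [[<-] []]]]]].
    by move=> h; right; right; exists p.+1.
- by rewrite nth_behead.
- by rewrite nth_behead.
- case: p => [|p] /=; first by split; [left|case=> [[]|[p' []]]].
  split; first by move=> h; right; exists p.
  by case=> [[]|[p' [_ [[<-]]]]].
- rewrite nth_behead_write; case: p => [|p] /=.
    by split; [left|case=> [[]|[]]].
  by split; [right|case=> [[]|[]]].
- by [].
Qed.

(** The asserted facts occur only positively; this gives both the soundness of a tableau and the
    freedom to omit facts. *)
Lemma next_fact_mono H1 H2 t p f q a :
  (forall p' f', p' <= p.+1 -> H1 t p' f' -> H2 t p' f') ->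
  next_fact H1 t p f q a -> next_fact H2 t p f q a.
Proof.
move=> h12; rewrite /next_fact; case: ifP => _; first exact: h12.
case: f => [q'|[[i r] s]] //; case: ((tm_trans q a).2 i) => wr mv.
rewrite /moved_fact /=.
case: mv; case: r.
- case=> [[p0 h]|[h|[p' [hp [pE [p0 h]]]]]]; [left|by right; left|right; right].
    by split=> //; apply: h12.
  by exists p'; do !split=> //; apply: h12 h; lia.
- exact: h12.
- exact: h12.
- case=> [h|[p' [hp [pE h]]]]; [by left|right].
  by exists p'; do !split=> //; apply: h12 h; lia.
- by case=> [h|[p0 h]]; [left|right; split=> //; apply: h12].
- exact: h12.
Qed.

Lemma tableau_sound H n T B : tableau H n T B ->
  (forall t p f, H t p f -> p < B) ->
  forall t p f, t <= T -> H t p f -> fact_holds n t p f.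
Proof.
move=> [h0 hS] hB; elim=> [|t IH] p f tT hf.
  exact/fact_holds_start/h0/hf/(hB _ _ _ hf).
have {}IH p' f' := IH p' f' (ltnW tT).
have [q [a [hq [ha hn]]]] := hS f t tT p (hB _ _ _ hf) hf.
apply/fact_holds_next.
have -> : cf_state (run n t) = q by apply/eqP; exact: (IH _ _ hq).
have -> : [ffun i => tape_read (cf_tape (run n t) i)] = a.
  by apply/ffunP => i; rewrite ffunE /tape_read -nth0; apply/eqP; exact: (IH _ _ (ha i)).
by apply: next_fact_mono hn => p' f' _; apply: IH.
Qed.

(* A fact at position p is justified by facts one step earlier at positions up
   to p + 1, hence the triangular shape. *)
Lemma tableau_complete n T B H : T < B ->
  (forall t p f, t <= T -> p < B -> (H t p f <-> t + p < B /\ fact_holds n t p f)) ->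
  tableau H n T B.
Proof.
move=> TB hH; split=> [f p hp|f t tT p hp].
  by rewrite hH // => -[_ /fact_holds_start].
rewrite hH // => -[hpt hf]; exists (cf_state (run n t)).
exists [ffun i => tape_read (cf_tape (run n t) i)].
split; first by rewrite hH /=; [rewrite eqxx; split=> //; lia|lia|lia].
split=> [i|].
  rewrite hH /=; [|lia|lia]; split; first by lia.
  by rewrite ffunE /tape_read nth0.
apply: next_fact_mono (proj1 (fact_holds_next n t p f) hf) => p' f' hp' hf'.
by rewrite hH; [split=> //; lia|lia|lia].
Qed.

(** A step adds at most two cells to the right part: one by writing on an empty list, one by moving
    left. *)
Lemma size_run_tape n t i : size (cf_tape (run n t) i).2 <= n + 2 * t.
Proof.
elim: t => [|t IH]; first by rewrite /= ffunE; case: ifP; rewrite ?size_map ?size_nseq ?muln0 ?addn0.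
rewrite /run iterS -/(run n t) /tm_step; case: ifP => _; first by lia.
case: (tm_trans _ _) => q act /=; rewrite ffunE; case: (act i) => wr [] /=;
  rewrite /= ?size_behead; move: IH; move: (size _) => m; lia.
Qed.

End Tableau.

(** * Reading circuit descriptions *)

Definition wire_tag (u : wire) : bool * bool :=
  match u with
  | Main _ => (false, false)
  | Aux _ => (false, true)
  | Gate _ => (true, false)
  end.

Definition wire_num (u : wire) : nat :=
  match u with Main i => i | Aux i => i | Gate i => i end.

Lemma wire_tag_num_inj u v :
  wire_tag u = wire_tag v -> wire_num u = wire_num v -> u = v.
Proof. by case: u => i; case: v => j //= _ ->. Qed.

Lemma wire_codeE u : wire_code u =
  [:: (wire_tag u).1, (wire_tag u).2 & nat_code (wire_num u)].
Proof. by case: u. Qed.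

Definition gate_op (g : gate) : bool * bool :=
  match g with
  | Not _ => (false, false)
  | And _ _ => (true, false)
  | Or _ _ => (true, true)
  end.

Lemma gate_codeE g : gate_code g =
  [:: (gate_op g).1, (gate_op g).2 & wire_code (gate_in1 g) ++
      if (gate_op g).1 then wire_code (gate_in2 g) else [::]].
Proof. by case: g => [u|u v|u v] //=; rewrite cats0. Qed.

Lemma size_nat_code i : size (nat_code i) = i.+1.
Proof. by rewrite /nat_code size_cat size_nseq addn1. Qed.

Lemma nth_nat_code i s r : r <= i -> nth false (nat_code i ++ s) r = (r < i).
Proof.
move=> ri; rewrite nth_cat size_nat_code ltnS ri /nat_code nth_cat size_nseq.
by case: ltnP => h; [rewrite nth_nseq h|rewrite (_ : r - i = 0) //; lia].
Qed.

Section Reading.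

(* [O p b] asserts that the description has bit [b] at position [p], and
   [P g p] that gate [g], or the final 0 if there are [g] gates, starts at
   position [p]. *)
Variables (B n : nat) (O : nat -> bool -> Prop) (P : nat -> nat -> Prop).

Definition nat_at (p i : nat) : Prop :=
  (forall r, r < i -> O (p + r) true) /\ O (p + i) false.

Definition wire_at (p : nat) (t1 t2 : bool) (i : nat) : Prop :=
  O p t1 /\ O p.+1 t2 /\ nat_at p.+2 i.

Definition some_wire_at (p i : nat) : Prop :=
  exists t1 : bool, exists t2 : bool, wire_at p t1 t2 i.

(** The offset 3 covers the leading 1 and the two operation bits, and the code of a wire numbered i
    has length 3 + i. The first operation bit tells whether there is a second input. *)
Definition gate_at (p p' : nat) : Prop :=
  O p true /\ exists i, i < B /\ (some_wire_at (p + 3) i /\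
    ((O p.+1 false /\ p' = p + 3 + (3 + i)) \/
     (O p.+1 true /\ exists j, j < B /\ (some_wire_at (p + 3 + (3 + i)) j /\
        p' = p + 3 + (3 + i) + (3 + j))))).

Definition gate_positions : Prop :=
  (forall p, p < B -> P 0 p -> exists i, i < p /\ (p = i.+1 /\ nat_at 0 i)) /\
  (forall g, g < B -> forall p', p' < B -> P g.+1 p' ->
     exists p, p < B /\ (P g p /\ gate_at p p')).

(** The counterpart of [slot], with a wire given by its tag and number. For a negation the second
    input slot repeats the only input, as in [gate_in2]. *)
Definition slot_at (i : nat) (t1 t2 : bool) (x : nat) : Prop :=
  (i < n /\ (~~ t1 && ~~ t2) /\ x = i) \/
  exists g, g < B /\ exists p, p < B /\ (P g p /\
    ((i = n /\ O p false /\ wire_at p.+1 t1 t2 x) \/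
     (O p true /\
      ((i = n.+1 + 3 * g /\ (t1 && ~~ t2) /\ x = g) \/
       (i = n.+1 + 3 * g + 1 /\ wire_at (p + 3) t1 t2 x) \/
       (i = n.+1 + 3 * g + 2 /\
         ((O p.+1 false /\ wire_at (p + 3) t1 t2 x) \/
          (O p.+1 true /\ exists y, y < B /\ (some_wire_at (p + 3) y /\
             wire_at (p + 3 + (3 + y)) t1 t2 x)))))))).

Definition clash_at (i j l : nat) (A1 A2 A3 : Prop) : Prop :=
  exists g, g < B /\ (i = n.+1 + 3 * g /\ j = i.+1 /\ l = i.+2 /\
    exists p, p < B /\ (P g p /\ O p true /\
     ((O p.+1 false /\ ~ (A1 <-> ~ A2)) \/
      (O p.+1 true /\ O p.+2 false /\ ~ (A1 <-> A2 /\ A3)) \/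
      (O p.+1 true /\ O p.+2 true /\ ~ (A1 <-> A2 \/ A3))))).

Definition violation_at (i j l : nat) (A1 A2 A3 : Prop) : Prop :=
  (exists x, x < B /\ exists t1 : bool, exists t2 : bool,
     slot_at i t1 t2 x /\ slot_at j t1 t2 x /\ ~ (A1 <-> A2)) \/
  (i = n /\ A1) \/ clash_at i j l A1 A2 A3.

End Reading.

(** * Soundness and completeness of the reading for the description of a given circuit *)

Section ReadingCircuit.

Variable C : circuit.
Notation code := (circuit_code C).
Notation gates := (c_gates C).

Definition gate_pos (g : nat) : nat :=
  size (nat_code (c_aux C)) +
  size (flatten [seq true :: gate_code G | G <- take g gates]).

Lemma drop_gate g G : onth gates g = Some G ->
  exists s, drop (gate_pos g) code = (true :: gate_code G) ++ s /\
            drop (gate_pos g.+1) code = s.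
Proof.
move=> hG; have hg : g < size gates by rewrite -onthTE hG.
have eG : nth G gates g = G by exact: onth_nth.
exists (flatten [seq true :: gate_code G' | G' <- drop g.+1 gates] ++
        false :: wire_code (c_out C)).
have E : flatten [seq true :: gate_code G | G <- gates] =
    flatten [seq true :: gate_code G | G <- take g gates] ++
    (true :: gate_code G) ++
    flatten [seq true :: gate_code G' | G' <- drop g.+1 gates].
  by rewrite -{1}(cat_take_drop g gates) map_cat flatten_cat (drop_nth G) //= eG.
rewrite /gate_pos /circuit_code E; move: (nat_code _) => a.
rewrite (take_nth G) // eG map_rcons -cats1 flatten_cat [flatten [:: _]]/= cats0.
move: (true :: gate_code G) => X; move: (flatten _) (flatten _) => s1 s2.
rewrite -!catA; split; first by rewrite catA drop_size_cat ?size_cat.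
by rewrite catA (catA _ X) drop_size_cat // !size_cat addnA.
Qed.

Lemma drop_end : drop (gate_pos (size gates)) code = false :: wire_code (c_out C).
Proof.
rewrite /gate_pos take_size /circuit_code; move: (nat_code _) => a.
by rewrite catA drop_size_cat ?size_cat.
Qed.

Lemma drop_gate_pos0 : drop 0 code = nat_code (c_aux C) ++ drop (gate_pos 0) code.
Proof.
rewrite drop0 /gate_pos take0 addn0 /circuit_code; move: (nat_code _) => a.
by rewrite drop_size_cat.
Qed.

Section Sound.

Variable O : nat -> bool -> Prop.
Hypothesis O_sound : forall p b, p < size code -> O p b -> nth false code p = b.

Lemma O_drop p r b s : drop p code = s -> r < size s -> O (p + r) b ->
  nth false s r = b.
Proof.
move=> <-; rewrite size_drop nth_drop => hr; apply: O_sound; lia.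
Qed.

(** A number read too small would claim a 0 inside the block of ones, and one read too large would
    claim a 1 at its terminator. Both conflicts lie inside the description, where [O_sound]
    applies. *)
Lemma nat_at_sound p i j s : drop p code = nat_code j ++ s -> nat_at O p i ->
  i = j /\ drop (p + j.+1) code = s.
Proof.
move=> hd [h1 h2]; split; last first.
  rewrite addnC -drop_drop hd drop_size_cat //.
  by rewrite size_nat_code.
have hs : size (nat_code j ++ s) = j.+1 + size s by rewrite size_cat size_nat_code.
have [hij|hij|//] := ltngtP i j.
  by have := O_drop hd _ h2; rewrite hs nth_nat_code ?hij ?(ltnW hij) //; lia.
by have := O_drop hd _ (h1 j hij); rewrite hs nth_nat_code // ltnn; lia.
Qed.

Lemma wire_at_sound p t1 t2 i u s : drop p code = wire_code u ++ s ->
  wire_at O p t1 t2 i ->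
  [/\ wire_tag u = (t1, t2), wire_num u = i & drop (p + (3 + i)) code = s].
Proof.
rewrite wire_codeE => hd [h1 [h2 h3]].
have e1 : (wire_tag u).1 = t1 by rewrite -[p]addn0 in h1; exact: (O_drop hd _ h1).
have e2 : (wire_tag u).2 = t2 by rewrite -addn1 in h2; exact: (O_drop hd _ h2).
have hd2 : drop p.+2 code = nat_code (wire_num u) ++ s.
  by rewrite -add2n -drop_drop hd /= drop0.
have [-> hs] := nat_at_sound hd2 h3; split=> //.
  by rewrite -e1 -e2; case: (wire_tag u).
by rewrite -hs; congr drop; lia.
Qed.

End Sound.

Section Complete.

Variable O : nat -> bool -> Prop.
Hypothesis O_complete : forall p, p < size code -> O p (nth false code p).

Lemma drop_O p r s : drop p code = s -> r < size s -> O (p + r) (nth false s r).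
Proof.
move=> <-; rewrite size_drop nth_drop => hr; apply: O_complete; lia.
Qed.

Lemma nat_at_complete p i s : drop p code = nat_code i ++ s -> nat_at O p i.
Proof.
move=> hd; have hs : size (nat_code i ++ s) = i.+1 + size s.
  by rewrite size_cat size_nat_code.
split=> [r ri|].
  have := drop_O (r := r) hd; rewrite hs nth_nat_code ?ri ?(ltnW ri) //; apply; lia.
by have := drop_O (r := i) hd; rewrite hs nth_nat_code // ltnn; apply; lia.
Qed.

Lemma wire_at_complete p u s : drop p code = wire_code u ++ s ->
  wire_at O p (wire_tag u).1 (wire_tag u).2 (wire_num u) /\
  drop (p + (3 + wire_num u)) code = s.
Proof.
rewrite wire_codeE => hd.
have hd2 : drop p.+2 code = nat_code (wire_num u) ++ s.
  by rewrite -add2n -drop_drop hd /= drop0.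
split; last first.
  have -> : p + (3 + wire_num u) = (wire_num u).+1 + p.+2 by lia.
  rewrite -drop_drop hd2 drop_size_cat //.
  by rewrite size_nat_code.
split; first by have := drop_O (r := 0) hd isT; rewrite addn0.
split; first by have := drop_O (r := 1) hd isT; rewrite addn1.
exact: nat_at_complete hd2.
Qed.

End Complete.

End ReadingCircuit.

Lemma size_wire_code u : size (wire_code u) = 3 + wire_num u.
Proof. by rewrite wire_codeE /= size_nat_code. Qed.

Lemma gate_clashP C n i j l (a1 a2 a3 : bool) :
  reflect (exists g G, [/\ onth (c_gates C) g = Some G, i = n.+1 + 3 * g,
             j = i.+1, l = i.+2 & a1 != gate_fun G a2 a3])
          (gate_clash C n i j l a1 a2 a3).
Proof.
apply: (iffP and5P) => [[ni d3 /eqP-> /eqP->]|[g [G [hG iE -> -> h]]]].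
  case hG: (onth _ _) => [G|] // h.
  exists ((i - n.+1) %/ 3), G; split=> //.
  by have := divnK d3; lia.
have e : i - n.+1 = g * 3 by lia.
by rewrite e dvdn_mull // mulnK // hG !eqxx; split=> //; lia.
Qed.

Definition gate_len (G : gate) : nat :=
  3 + (3 + wire_num (gate_in1 G)) +
  (if (gate_op G).1 then 3 + wire_num (gate_in2 G) else 0).

Section ReadingGates.

Variables (C : circuit) (n B : nat).
Notation code := (circuit_code C).
Notation gates := (c_gates C).
Notation gpos := (gate_pos C).

Definition gate_here (p : nat) (G : gate) (s : seq bool) : Prop :=
  drop p code = [:: true, (gate_op G).1, (gate_op G).2 & wire_code (gate_in1 G) ++
    (if (gate_op G).1 then wire_code (gate_in2 G) else [::]) ++ s].

Lemma gate_hereP g G : onth gates g = Some G ->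
  exists s, gate_here (gpos g) G s.
Proof.
move=> hG; have [s [h _]] := drop_gate hG; exists s.
by rewrite /gate_here h gate_codeE /= -catA.
Qed.

Lemma gate_posS g G : onth gates g = Some G -> gpos g.+1 = gpos g + gate_len G.
Proof.
move=> hG; have hg : g < size gates by rewrite -onthTE hG.
have eG : nth G gates g = G by exact: onth_nth.
rewrite /gate_pos (take_nth G) // eG map_rcons -cats1 flatten_cat size_cat addnA.
rewrite [flatten [:: _]]/= cats0 gate_codeE /gate_len /= size_cat size_wire_code.
by case: (gate_op G).1; rewrite ?size_wire_code /=; lia.
Qed.

Lemma gate_here_drop p G s : gate_here p G s ->
  drop (p + 3) code = wire_code (gate_in1 G) ++
    (if (gate_op G).1 then wire_code (gate_in2 G) else [::]) ++ s.
Proof. by move=> h; rewrite addnC -drop_drop h /= drop0. Qed.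

(** Each gate occupies at least one bit, so gate indices are bounded by the length of the
    description, as positions are. *)
Lemma gate_pos_lt g : g <= size gates -> g < size code /\ gpos g < size code.
Proof.
move=> hg.
have lt p b s : drop p code = b :: s -> p < size code.
  by case: ltnP => // hp; rewrite drop_oversize.
have hp : gpos g < size code.
  move: hg; rewrite leq_eqVlt => /orP[/eqP->|hg]; first exact: lt (drop_end C).
  case hG: (onth gates g) => [G|]; last by move: hg; rewrite -onthTE hG.
  by have [s /lt] := gate_hereP hG.
suff : g <= gpos g by move=> h; split=> //; exact: leq_ltn_trans hp.
elim: g hg {hp} => // g IH hg.
case hG: (onth gates g) => [G|]; last by move: hg; rewrite -onthTE hG.
by rewrite (gate_posS hG) /gate_len; have := IH (ltnW hg); lia.
Qed.

Lemma wire_num_lt p u s : drop p code = wire_code u ++ s -> wire_num u < size code.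
Proof.
move/(congr1 size); rewrite size_drop size_cat size_wire_code; lia.
Qed.

Section Sound.

Variables (O : nat -> bool -> Prop) (P : nat -> nat -> Prop).
Hypothesis O_sound : forall p b, p < size code -> O p b -> nth false code p = b.
Hypothesis P_lt : forall g p, P g p -> p < B.
Hypothesis P_ok : gate_positions B O P.

Lemma gate_here_sound p G s : gate_here p G s ->
  (forall b, O p.+1 b -> (gate_op G).1 = b) /\
  (forall b, O p.+2 b -> (gate_op G).2 = b).
Proof.
move=> h; split=> b; first by rewrite -addn1 => hb; exact: (O_drop O_sound h _ hb).
by rewrite -addn2 => hb; exact: (O_drop O_sound h _ hb).
Qed.

Lemma some_wire_at_sound p u s i : drop p code = wire_code u ++ s ->
  some_wire_at O p i -> wire_num u = i /\ drop (p + (3 + i)) code = s.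
Proof.
by move=> hd [t1 [t2 hw]]; have [_ -> ->] := wire_at_sound O_sound hd hw.
Qed.

Lemma O_true g : g <= size gates -> O (gpos g) true ->
  exists G, onth gates g = Some G.
Proof.
move=> hg ho; case hG: (onth gates g) => [G|]; first by exists G.
have gE : g = size gates by apply/eqP; rewrite eqn_leq hg -onthNE hG.
rewrite gE in ho; by rewrite -[gpos _]addn0 in ho;
  have := O_drop (r := 0) O_sound (drop_end C) isT ho.
Qed.

Lemma O_false g : g <= size gates -> O (gpos g) false -> g = size gates.
Proof.
rewrite leq_eqVlt => /orP[/eqP //|hg] ho.
case hG: (onth gates g) => [G|]; last by move: hg; rewrite -onthTE hG.
have [s hs] := gate_hereP hG.
by rewrite -[gpos _]addn0 in ho; have := O_drop (r := 0) O_sound hs isT ho.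
Qed.

Lemma gate_at_sound g G p' : onth gates g = Some G -> gate_at B O (gpos g) p' ->
  p' = gpos g.+1.
Proof.
move=> hG; have [s hs] := gate_hereP hG; have hd := gate_here_drop hs.
have [ho1 _] := gate_here_sound hs.
case=> _ [i [_ [/(some_wire_at_sound hd)[iE hd']]]].
rewrite (gate_posS hG) /gate_len iE.
case=> [[/ho1-> ->]|[/ho1 o1 [j [_ [hw ->]]]]]; first by lia.
rewrite o1 in hd' *.
by have [-> _] := some_wire_at_sound hd' hw; lia.
Qed.

(** By induction on g: the justification of the next position includes a bit 1 at the current one,
    so the current gate exists and the scan cannot pass the end of the list. *)
Lemma gate_pos_sound g p : g <= B -> P g p -> g <= size gates /\ p = gpos g.
Proof.
have [h0 hS] := P_ok; elim: g p => [|g IH] p hg hp.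
  have [i [_ [-> hi]]] := h0 p (P_lt hp) hp; split=> //.
  have [-> _] := nat_at_sound O_sound (drop_gate_pos0 C) hi.
  by rewrite /gate_pos take0 addn0 size_nat_code.
have [p0 [_ [hp0 hat]]] := hS g hg p (P_lt hp) hp.
have [gs pE] := IH p0 (ltnW hg) hp0; rewrite pE in hat.
have [G hG] := O_true gs (proj1 hat).
by split; [rewrite -onthTE hG|exact: gate_at_sound hG hat].
Qed.

Lemma slot_at_sound i t1 t2 x : slot_at B n O P i t1 t2 x ->
  exists u, [/\ slot C n i = Some u, wire_tag u = (t1, t2) & wire_num u = x].
Proof.
case=> [[hi [/andP[/negPf-> /negPf->] ->]]|].
  by exists (Main i); rewrite slot_main.
case=> g [hg [p [_ [hp]]]]; have [gs pE] := gate_pos_sound (ltnW hg) hp.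
rewrite pE => -[[-> [/(O_false gs) gE hw]]|[/(O_true gs)[G hG]]].
  exists (c_out C); rewrite slot_out; rewrite gE in hw.
  have hd : drop (gpos (size gates)).+1 code = wire_code (c_out C) ++ [::].
    by rewrite cats0 -add1n -drop_drop drop_end /= drop0.
  by have [] := wire_at_sound O_sound hd hw.
have [s hs] := gate_hereP hG; have hd := gate_here_drop hs.
have [ho1 _] := gate_here_sound hs.
case=> [[-> [/andP[-> /negPf->] ->]]|[[-> hw]|[-> hw]]].
- by exists (Gate g); rewrite -[_ + 3 * g]addn0 (slot_gate n hG).
- exists (gate_in1 G); rewrite (slot_gate n hG) //.
  by have [] := wire_at_sound O_sound hd hw.
exists (gate_in2 G); rewrite (slot_gate n hG) //.
case: hw => [[/ho1 o1 hw]|[/ho1 o1 [y [_ [hy hw]]]]].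
  have <- : gate_in1 G = gate_in2 G by case: (G) o1.
  by have [] := wire_at_sound O_sound hd hw.
have [_ hd'] := some_wire_at_sound hd hy; rewrite o1 in hd'.
by have [] := wire_at_sound O_sound hd' hw.
Qed.

Lemma violation_at_sound i j l (a1 a2 a3 : bool) :
  violation_at B n O P i j l a1 a2 a3 -> violated C n i j l a1 a2 a3.
Proof.
rewrite /violated => -[[x [_ [t1 [t2 [/slot_at_sound[u [si tu nu]]
  [/slot_at_sound[v [sj tv nv]] h]]]]]]|[[-> ->]|]].
- apply/orP; left; rewrite /same_wire si sj (@wire_tag_num_inj u v) ?tu ?nu //.
  by rewrite eqxx /=; case: (a1) (a2) h => -[] // [].
- by rewrite eqxx /= orbT.
case=> g [hg [-> [-> [-> [p [_ [hp]]]]]]].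
have [gs ->] := gate_pos_sound (ltnW hg) hp.
case=> /(O_true gs)[G hG]; have [s hs] := gate_hereP hG.
have [ho1 ho2] := gate_here_sound hs.
move=> h; apply/orP; right; apply/orP; right; apply/gate_clashP.
exists g, G; split=> //; case: h => [[/ho1 o1 h]|[[/ho1 o1 [/ho2 o2 h]]|
  [/ho1 o1 [/ho2 o2 h]]]].
- case: (G) o1 => //= u _; apply/negP => /eqP a1E; apply: h; rewrite a1E.
  by split=> /negP.
- case: (G) o1 o2 => //= u v _ _; apply/negP => /eqP a1E; apply: h.
  by rewrite a1E; split=> /andP.
- case: (G) o1 o2 => //= u v _ _; apply/negP => /eqP a1E; apply: h.
  by rewrite a1E; split=> /orP.
Qed.

End Sound.

Section Complete.

Variables (O : nat -> bool -> Prop) (P : nat -> nat -> Prop).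
Hypothesis O_complete : forall p, p < size code -> O p (nth false code p).
Hypothesis code_lt : size code <= B.
Hypothesis PE : forall g p, g <= B -> p < B ->
  (P g p <-> g <= size gates /\ p = gpos g).

Lemma gate_lt g : g <= size gates -> g < B /\ gpos g < B.
Proof. by move=> /gate_pos_lt[h1 h2]; split; apply: leq_trans code_lt. Qed.

Lemma num_lt p u s : drop p code = wire_code u ++ s -> wire_num u < B.
Proof. by move=> /wire_num_lt h; apply: leq_trans code_lt. Qed.

Lemma P_gate_pos g : g <= size gates -> P g (gpos g).
Proof. by move=> hg;
  have [h1 h2] := gate_lt hg; apply/PE => //; exact: ltnW. Qed.

Lemma gate_here_complete p G s : gate_here p G s ->
  [/\ O p true, O p.+1 (gate_op G).1 & O p.+2 (gate_op G).2].
Proof.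
move=> h; split.
- by have := drop_O (r := 0) O_complete h isT; rewrite addn0.
- by have := drop_O (r := 1) O_complete h isT; rewrite addn1.
- by have := drop_O (r := 2) O_complete h isT; rewrite addn2.
Qed.

Lemma some_wire_at_complete p u s : drop p code = wire_code u ++ s ->
  [/\ wire_num u < B, some_wire_at O p (wire_num u) &
      drop (p + (3 + wire_num u)) code = s].
Proof.
move=> hd; have [h1 h2] := wire_at_complete O_complete hd.
by split=> //; [exact: num_lt hd|exists (wire_tag u).1, (wire_tag u).2].
Qed.

Lemma gate_at_complete g G : onth gates g = Some G ->
  gate_at B O (gpos g) (gpos g.+1).
Proof.
move=> hG; have [s hs] := gate_hereP hG.
have [h0 h1 _] := gate_here_complete hs; split=> //.
have [i1 w1 hd] := some_wire_at_complete (gate_here_drop hs).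
exists (wire_num (gate_in1 G)); split=> //; split=> //.
rewrite (gate_posS hG) /gate_len.
case: (gate_op G).1 h1 hd => h1 hd; [right|left]; split=> //; try by lia.
have [i2 w2 _] := some_wire_at_complete hd.
by exists (wire_num (gate_in2 G)); do !split=> //; lia.
Qed.

Lemma gate_positions_complete : gate_positions B O P.
Proof.
split=> [p hp /PE[] // _ ->|g hg p' hp' /PE[] // gs ->].
  exists (c_aux C); rewrite /gate_pos take0 addn0 size_nat_code; split=> //.
  by split=> //; exact: (nat_at_complete O_complete (drop_gate_pos0 C)).
have [h1 h2] := gate_lt (ltnW gs); exists (gpos g); split=> //.
split; first exact/P_gate_pos/ltnW.
case hG: (onth gates g) => [G|]; first exact: (gate_at_complete hG).
by move: gs; rewrite -onthTE hG.
Qed.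

Lemma slot_at_complete i u : slot C n i = Some u ->
  slot_at B n O P i (wire_tag u).1 (wire_tag u).2 (wire_num u).
Proof.
move=> /slotP[[hi ->]|[-> ->]|[g [r [G [hG hr -> ->]]]]]; first by left.
  have hd : drop (gpos (size gates)).+1 code = wire_code (c_out C) ++ [::].
    by rewrite cats0 -add1n -drop_drop drop_end /= drop0.
  have [h1 h2] := gate_lt (leqnn _).
  right; exists (size gates); split=> //; exists (gpos (size gates)); split=> //.
  split; first exact: P_gate_pos.
  left; split=> //; split; last by have [] := wire_at_complete O_complete hd.
  have := drop_O (r := 0) O_complete (drop_end C) isT.
  by rewrite addn0.
have gs : g <= size gates by rewrite ltnW // -onthTE hG.
have [h1 h2] := gate_lt gs; have [s hs] := gate_hereP hG.
have [o0 o1 _] := gate_here_complete hs; have hd := gate_here_drop hs.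
right; exists g; split=> //; exists (gpos g); split=> //.
split; first exact: P_gate_pos.
right; split=> //; case: r hr => [|[|[|]]] // _.
- by left; rewrite addn0.
- by right; left; split=> //; have [] := wire_at_complete O_complete hd.
right; right; split=> //; case e1: (gate_op G).1 o1 hd => o1 hd; [right|left]; split=> //.
  have [i1 w1 hd'] := some_wire_at_complete hd.
  exists (wire_num (gate_in1 G)); split=> //; split=> //.
  by have [] := wire_at_complete O_complete hd'.
have -> : gate_in2 G = gate_in1 G by case: (G) e1.
by have [] := wire_at_complete O_complete hd.
Qed.

Lemma violation_at_complete i j l (a1 a2 a3 : bool) : n <= B ->
  violated C n i j l a1 a2 a3 -> violation_at B n O P i j l a1 a2 a3.
Proof.
move=> nB /or3P[/andP[/andP[]]|/andP[/eqP-> ha]|/gate_clashP[g [G [hG -> -> -> h]]]].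
- case si: (slot C n i) => [u|] // _ /eqP sj a12; left.
  exists (wire_num u); split.
    move: si => /slotP[[hi ->]|[_ ->]|[g [r [G [hG hr _ ->]]]]].
    + exact: leq_trans nB.
    + have hd : drop (gpos (size gates)).+1 code = wire_code (c_out C) ++ [::].
        by rewrite cats0 -add1n -drop_drop drop_end /= drop0.
      exact: num_lt hd.
    have gs : g <= size gates by rewrite ltnW // -onthTE hG.
    have [h1 h2] := gate_lt gs; have [s hs] := gate_hereP hG.
    have hd := gate_here_drop hs; have i1 := num_lt hd.
    case: r hr => [|[|[|]]] // _.
    case e1: (gate_op G).1 hd => hd; last by case: (G) e1 i1.
    have [_ _ hd'] := some_wire_at_complete hd; exact: num_lt hd'.
  exists (wire_tag u).1, (wire_tag u).2; split; first exact: slot_at_complete.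
  split; first exact/slot_at_complete/esym.
  by case: (a1) (a2) a12 => -[] // _ [h1 h2]; [move: (h1 isT)|move: (h2 isT)].
- by right; left.
right; right; have gs : g <= size gates by rewrite ltnW // -onthTE hG.
have [h1 h2] := gate_lt gs; have [s hs] := gate_hereP hG.
have [o0 o1 o2] := gate_here_complete hs.
exists g; split=> //; do 3!split=> //; exists (gpos g); split=> //.
split; first exact: P_gate_pos.
split=> //; case: (G) o1 o2 h => [u|u v|u v] /= o1 o2 h.
- left; split=> // hh; move/negP: h; apply; apply/eqP; apply/idP/idP.
    by move/hh/negP.
  by move/negP/hh.
- right; left; do !split=> //; move=> hh; move/negP: h; apply; apply/eqP; apply/idP/idP.
    by move/hh/andP.
  by move/andP/hh.
- right; right; do !split=> //; move=> hh; move/negP: h; apply; apply/eqP; apply/idP/idP.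
    by move/hh/orP.
  by move/orP/hh.
Qed.

End Complete.

End ReadingGates.

(** * Violated constraints of a uniform circuit family *)

Lemma nth_leading_bits (G : finType) (r : seq (symbol G)) p :
  p < size (leading_bits r) -> nth None r p = Some (inl (nth false (leading_bits r) p)).
Proof. by elim: r p => //= -[[b|g]|] r IH [|p] //= /IH. Qed.

Lemma size_leading_bits (G : finType) (r : seq (symbol G)) :
  size (leading_bits r) <= size r.
Proof. by elim: r => //= -[[b|g]|]. Qed.

Definition violation_language (k : nat) (C : nat -> circuit) : language := fun q =>
  exists b i j l a1 a2 a3,
    [/\ 0 < b, [/\ i < b ^ num_digits k, j < b ^ num_digits k & l < b ^ num_digits k],
        q = query (num_digits k) b i j l a1 a2 a3 &
        violated (C (b ^ len_exp k)) (b ^ len_exp k) i j l a1 a2 a3].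

(** The facts to be written down form an arbitrary proposition, so each bit is chosen by excluded
    middle. *)
Lemma table_exists (K : finType) (B : nat) (Q : nat -> nat -> K -> Prop) :
  exists y : seq bool, size y = B.+1 * B * #|K| /\
    forall t p (f : K), t <= B -> p < B ->
      nth false y ((t * B + p) * #|K| + enum_rank f) <-> Q t p f.
Proof.
case: (pickP (mem K)) => [f0 _|K0]; last first.
  exists (nseq (B.+1 * B * #|K|) false); rewrite size_nseq; split=> // t p f.
  by have := K0 f.
pose y := mkseq (fun z => if excluded_middle_informative
  (Q (z %/ #|K| %/ B) (z %/ #|K| %% B) (nth f0 (enum K) (z %% #|K|))) then true else false)
  (B.+1 * B * #|K|).
exists y; rewrite size_mkseq; split=> // t p f tB pB.
have rf := ltn_ord (enum_rank f); move: (rf) => rf'.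
have K0 : 0 < #|K| by apply: leq_ltn_trans rf.
have B0 : 0 < B by apply: leq_ltn_trans pB.
rewrite nth_mkseq; last first.
  have : t * B + p < B.+1 * B by nia.
  move: (t * B + p) (B.+1 * B) => u v uv.
  by apply: leq_trans (leq_mul uv (leqnn _)); rewrite mulSn addnC ltn_add2r.
rewrite (divnMDl _ _ K0) (divn_small rf') addn0 (modnMDl _ _ #|K|) (modn_small rf').
rewrite (divnMDl _ _ B0) (divn_small pB) addn0 (modnMDl _ _ B) (modn_small pB).
rewrite nth_enum_rank.
by case: excluded_middle_informative.
Qed.

(** * The violation language of a uniform family is in NP *)

Section Uniform.

Variables (k c : nat) (M : tm) (C : nat -> circuit).
Hypothesis MC : forall n,
  tm_computes_in M (nseq n true) (poly_bound c n) (circuit_code (C n)).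

Notation e := (len_exp k).
Notation d := (num_digits k).
Notation K := (option (fact M)).

(* The table of asserted facts; [None] tags the positions of gates. *)
Definition entry (w : seq bool) (o B t p : nat) (f : K) : Prop :=
  p < B /\ nth false w ((t * B + p) * #|{: K}| + enum_rank f + o).

Definition output_bit (w : seq bool) (o B T p : nat) (b : bool) : Prop :=
  entry w o B T p (Some (fcell ord_max true (Some (inl b)))).

Definition violation_body (w : seq bool) (s b n T B : nat) : Prop :=
  tableau (fun t p f => entry w (2 * s + 2) B t p (Some f)) n T B /\
  (gate_positions B (output_bit w (2 * s + 2) B T)
    (fun g p => entry w (2 * s + 2) B g p None) /\
  exists i, i < b ^ d /\ exists j, j < b ^ d /\ exists l, l < b ^ d /\
    (codes_query d w 2 0 b i j l
      (nth false w (2 * (3 * (d * b)) + 0)) (nth false w (2 * (3 * (d * b) + 1) + 0))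
      (nth false w (2 * (3 * (d * b) + 2) + 0)) /\
    violation_at B n (output_bit w (2 * s + 2) B T)
      (fun g p => entry w (2 * s + 2) B g p None) i j l
      (nth false w (2 * (3 * (d * b)) + 0)) (nth false w (2 * (3 * (d * b) + 1) + 0))
      (nth false w (2 * (3 * (d * b) + 2) + 0)))).

(** The time bound is written out so that it is a term in n. The side B is only guessed, as a
    tableau is sound for every side. *)
Definition violation_check (w : seq bool) (m : nat) : Prop :=
  exists s, s < m /\ (is_pair w s /\ exists b, b < m /\ (0 < b /\
    s = query_size d b /\ exists n, n < m /\ (n = b ^ e /\
    exists T, T < m /\ (T = n ^ c + c /\
    exists B, B < m /\ violation_body w s b n T B)))).

Lemma df_entry (G : context) (o B t p : G -> nat) f :
  definable_term o -> definable_term B ->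
  definable_term t -> definable_term p ->
  definable (fun w (z : G) => entry w (o z) (B z) (t z) (p z) f).
Proof. by move=> ho hB ht hp; rewrite /entry; dform. Qed.

Lemma df_output_bit (G : context) (o B T p : G -> nat) b :
  definable_term o -> definable_term B ->
  definable_term T -> definable_term p ->
  definable (fun w (z : G) => output_bit w (o z) (B z) (T z) (p z) b).
Proof. exact: df_entry. Qed.

Ltac datom :=
  dform; first [apply: df_entry; dterm | apply: df_output_bit; dterm].

Lemma df_start_fact (G : context) (n p : G -> nat) (f : fact M) :
  definable_term n -> definable_term p ->
  definable (fun _ (z : G) => start_fact (n z) (p z) f).
Proof.
move=> hn hp; rewrite /start_fact; case: f => [q|[[i r] s]]; first by dform.
by case: (r && (i == ord0)); dform.
Qed.

Lemma df_next_fact (G : context) (o B t p : G -> nat) (f : fact M) q a :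
  definable_term o -> definable_term B -> definable_term t -> definable_term p ->
  definable (fun w (z : G) =>
    next_fact (fun (t p : nat) f => entry w (o z) (B z) t p (Some f)) (t z) (p z) f q a).
Proof.
move=> ho hB ht hp; rewrite /next_fact; case: (tm_halt q); first by datom.
case: f => [q'|[[i r] s]]; first by dform.
rewrite /moved_fact; case: ((tm_trans q a).2 i) => wr mv /=; case: mv; case: r; datom.
Qed.

Lemma df_tableau (G : context) (o B n T : G -> nat) :
  definable_term o -> definable_term B ->
  definable_term n -> definable_term T ->
  definable (fun w (z : G) =>
    tableau (fun (t p : nat) (f : fact M) => entry w (o z) (B z) t p (Some f))
      (n z) (T z) (B z)).
Proof.
move=> ho hB hn hT; rewrite /tableau; apply: df_and; apply: df_fin_all => f;
  dform; try by datom.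
- by apply: df_start_fact; dterm.
- by apply: df_next_fact; dterm.
Qed.

Lemma df_wire_at (G : context) (o B T p x : G -> nat) t1 t2 :
  definable_term o -> definable_term B ->
  definable_term T -> definable_term p -> definable_term x ->
  definable (fun w (z : G) =>
    wire_at (output_bit w (o z) (B z) (T z)) (p z) t1 t2 (x z)).
Proof. by move=> ho hB hT hp hx; rewrite /wire_at /nat_at; datom. Qed.

Lemma df_some_wire_at (G : context) (o B T p x : G -> nat) :
  definable_term o -> definable_term B ->
  definable_term T -> definable_term p -> definable_term x ->
  definable (fun w (z : G) =>
    some_wire_at (output_bit w (o z) (B z) (T z)) (p z) (x z)).
Proof. by move=> *; rewrite /some_wire_at; dform; apply: df_wire_at. Qed.

Ltac dread :=
  dform; first [apply: df_entry; dterm | apply: df_output_bit; dterm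
    | apply: df_wire_at; dterm | apply: df_some_wire_at; dterm].

Lemma df_gate_at (G : context) (o B T p : G -> nat) (p' : G -> nat) :
  definable_term o -> definable_term B ->
  definable_term T -> definable_term p -> definable_term p' ->
  definable (fun w (z : G) =>
    gate_at (B z) (output_bit w (o z) (B z) (T z)) (p z) (p' z)).
Proof. by move=> *; rewrite /gate_at; dread. Qed.

Lemma df_slot_at (G : context) (o B n T i x : G -> nat) t1 t2 :
  definable_term o -> definable_term B ->
  definable_term n -> definable_term T -> definable_term i -> definable_term x ->
  definable (fun w (z : G) => slot_at (B z) (n z) (output_bit w (o z) (B z) (T z))
    (fun g p : nat => entry w (o z) (B z) g p None) (i z) t1 t2 (x z)).
Proof. by move=> *; rewrite /slot_at; dread. Qed.

Lemma df_gate_positions (G : context) (o B T : G -> nat) :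
  definable_term o -> definable_term B ->
  definable_term T ->
  definable (fun w (z : G) =>
    gate_positions (B z) (output_bit w (o z) (B z) (T z))
      (fun g p : nat => entry w (o z) (B z) g p None)).
Proof.
move=> *; rewrite /gate_positions /nat_at; dform.
all: try by dread.
by apply: df_gate_at; dterm.
Qed.

Lemma df_violation_at (G : context) (o B n T i j l p1 p2 p3 : G -> nat) :
  definable_term o -> definable_term B -> definable_term n -> definable_term T ->
  definable_term i -> definable_term j -> definable_term l ->
  definable_term p1 -> definable_term p2 -> definable_term p3 ->
  definable (fun w (z : G) => violation_at (B z) (n z)
    (output_bit w (o z) (B z) (T z)) (fun g p : nat => entry w (o z) (B z) g p None)
    (i z) (j z) (l z) (nth false w (p1 z)) (nth false w (p2 z)) (nth false w (p3 z))).
Proof.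
by move=> *; rewrite /violation_at /clash_at; dform; try dread;
  apply: df_slot_at; dterm.
Qed.

Lemma df_violation_check :
  definable (fun w (m : length_context) => violation_check w m).
Proof.
rewrite /violation_check /query_size; dform; first by apply: df_is_pair; dterm.
rewrite /violation_body; dform.
- by apply: df_tableau; dterm.
- by apply: df_gate_positions; dterm.
- by apply: df_codes_query; by [dterm|dform].
- by apply: df_violation_at; dterm.
Qed.

(** An output bit lies at a position below n + 2T and is needed at time T; the triangular table
    keeps it only if time plus position is below the side, whence n + 3T + 1. *)
Definition table_side (b : nat) : nat :=
  b ^ e + 3 * poly_bound c (b ^ e) + 1.

Lemma output_code n p : p < size (circuit_code (C n)) ->
  nth None (cf_tape (run M n (poly_bound c n)) ord_max).2 p =
  Some (inl (nth false (circuit_code (C n)) p)).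
Proof. by have [_ <-] := MC n; exact: nth_leading_bits. Qed.

Lemma size_output_code n : size (circuit_code (C n)) <= n + 2 * poly_bound c n.
Proof.
have [_ <-] := MC n; apply: leq_trans (size_leading_bits _) _.
exact: size_run_tape.
Qed.

Lemma violation_check_sound q y :
  violation_check (pair_code q y) (size (pair_code q y)) ->
  violation_language k C q.
Proof.
case=> s [_ [/is_pairE-> [b [_ [b0 [sE [n [_ [nE [T [_ [TE [B [_]]]]]]]]]]]]]].
case=> [htab [hpos [i [hi [j [hj [l [hl [hq hv]]]]]]]]].
set a1 := nth _ _ _ in hq hv; set a2 := nth _ _ _ in hq hv.
set a3 := nth _ _ _ in hq hv.
exists b, i, j, l, a1, a2, a3; split=> //.
  apply: (@eq_from_nth _ false); first by rewrite size_query.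
  move=> p hp; rewrite -(nth_pair_code0 y hp).
  have /(_ p) := proj1 (codes_queryE d _ 2 0 i j l a1 a2 a3 b0) hq.
  by rewrite addn0 -sE; apply.
rewrite -nE; have TP : T = poly_bound c n by rewrite TE.
apply: violation_at_sound hv => //; last by move=> g p [].
move=> p b' hp ho.
have := tableau_sound htab (fun t p f h => proj1 h) (leqnn T) ho.
by rewrite /= TP (output_code hp) => /eqP[].
Qed.

Lemma violation_check_complete q : violation_language k C q ->
  exists y, (exists b, b <= size q /\
      size y = (table_side b).+1 * table_side b * #|{: K}|) /\
    violation_check (pair_code q y) (size (pair_code q y)).
Proof.
case=> b [i [j [l [a1 [a2 [a3 [b0 [hi hj hl] qE hv]]]]]]].
have sq : size q = query_size d b by rewrite qE size_query.
pose n := b ^ e; pose T := poly_bound c n; pose B := table_side b.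
have BE : B = n + 3 * T + 1 by [].
pose Q t p (f : K) := match f with
  | Some f => t + p < B /\ fact_holds n t p f
  | None => t <= size (c_gates (C n)) /\ p = gate_pos (C n) t
  end.
have [y [sy hy]] := table_exists B Q.
have bq : b <= size q.
  rewrite sq /query_size;
    have : b <= d * b by rewrite leq_pmull // /num_digits addn2.
  by lia.
exists y; split; first by exists b.
have F0 : 0 < #|{: K}| by apply/card_gt0P; exists None.
have By : B <= size y.
  by rewrite sy; apply: leq_trans (leq_pmulr _ F0); rewrite leq_pmull.
have entryE t p f : t <= B -> p < B ->
    (entry (pair_code q y) (2 * size q + 2) B t p f <-> Q t p f).
  move=> tB pB; rewrite /entry addnC nth_pair_codeR hy //.
  by split=> // -[].
have bn : b <= n by rewrite /n /len_exp addn1 -[X in X <= _]expn1 leq_pexp2l.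
have sw := size_pair_code q y.
exists (size q); split; first by rewrite sw; lia.
split; first exact/is_pairE.
exists b; split; first by rewrite sw; lia.
split=> //; split=> //; exists n; split; first by rewrite sw; lia.
split=> //; exists T; split; first by rewrite sw; lia.
split=> //; exists B; split; first by rewrite sw; lia.
have hout : forall p, p < size (circuit_code (C n)) ->
    output_bit (pair_code q y) (2 * size q + 2) B T p
      (nth false (circuit_code (C n)) p).
  move=> p hp; have hs := size_output_code n; rewrite -/T in hs.
  by apply/entryE; [lia|lia|split; [lia|rewrite /= output_code]].
have codeB : size (circuit_code (C n)) <= B.
  by have := size_output_code n; rewrite -/T; lia.
have PE g p : g <= B -> p < B -> (entry (pair_code q y) (2 * size q + 2) B g p None <->
    g <= size (c_gates (C n)) /\ p = gate_pos (C n) g).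
  exact: entryE.
split.
  apply: tableau_complete; first by lia.
  by move=> t p f tT pB; apply: entryE => //; lia.
split; first exact: gate_positions_complete hout codeB PE.
exists i; split=> //; exists j; split=> //; exists l; split=> //.
have bitE u : u < 3 ->
    nth false (pair_code q y) (2 * (3 * (d * b) + u) + 0) = nth false [:: a1; a2; a3] u.
  move=> u3; rewrite addn0 nth_pair_code0 qE ?nth_query_bit // size_query.
  by rewrite /query_size; lia.
rewrite -[in 2 * (3 * (d * b))](addn0 (3 * (d * b))) !bitE //=.
split; last by apply: (violation_at_complete hout codeB PE) hv; lia.
apply/codes_queryE => // p hp.
by rewrite addn0 nth_pair_code0 qE // size_query.
Qed.

Lemma NP_violation_language : NP (violation_language k C).
Proof.
have : pbounded (fun b => (table_side b).+1 * table_side b * #|{: K}|).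
  have hn : pbounded (fun b => b ^ e) by exact/pbounded_exp/pbounded_id.
  have hB : pbounded table_side.
    apply: pbounded_add (pbounded_cst _); apply: pbounded_add => //.
    apply: pbounded_mul; first exact: pbounded_cst.
    by apply: pbounded_add (pbounded_cst _); exact: pbounded_exp.
  apply: pbounded_mul (pbounded_cst _); apply: pbounded_mul => //.
  apply: (@pbounded_le _ (fun b => table_side b + 1)); first by move=> b; rewrite addn1.
  exact: pbounded_add (pbounded_cst _).
case=> a ha; have [c' hc'] := poly_bound_pow a 0.
have [R [c'' [hR hL]]] := NP_definable c' df_violation_check.
exists R, c''; split=> // q; rewrite -hL; split.
  move=> /violation_check_complete[y [[b [bq sy]] h]]; exists y; split=> //.
  rewrite sy; apply: leq_trans (ha b) _; apply: leq_trans (hc' _).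
  by rewrite addn0; case: (posnP a) => [->|a0] //; rewrite leq_exp2r.
by case=> y [_ /violation_check_sound].
Qed.

End Uniform.

(** * Diagonalization *)

Lemma co_acceptsN C x :
  ~ co_accepts C x <-> exists z : (c_aux C).-tuple bool, ~~ circuit_eval C x z.
Proof.
split=> [h|[z /negP hz] h]; last exact/hz/h.
apply/existsP; apply: contra_notT h => /existsPn h z.
by have := h z; rewrite negbK.
Qed.

(** The decoding inverts [table_index]: the last base-8 digit holds the three values, and the rest
    holds the three positions in base V. *)
Definition violation_table (C : circuit) (n V : nat) (len : nat) : seq bool :=
  mkseq (fun p => let r := p %/ 8 in let s := p %% 8 in
    violated C n (r %/ V %/ V) (r %/ V %% V) (r %% V)
      (4 <= s) (odd (s %/ 2)) (odd s)) len.

Lemma nth_violation_table C n V len i j l (a1 a2 a3 : bool) :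
  V ^ 3 * 8 <= len -> i < V -> j < V -> l < V ->
  nth false (violation_table C n V len) (table_index V i j l a1 a2 a3) =
  violated C n i j l a1 a2 a3.
Proof.
move=> hV hi hj hl; have V0 : 0 < V by lia.
have ha : a1 * 4 + a2 * 2 + a3 < 8 by case: a1; case: a2; case: a3.
rewrite nth_mkseq; last first.
  apply: leq_trans hV; rewrite /table_index.
  have h1 : i * V + j < V * V by nia.
  have h2 : (i * V + j) * V + l < V ^ 3 by rewrite !expnS expn0; nia.
  by move: (_ + a3) ha => a ha; nia.
rewrite /table_index divnMDl // (divn_small ha) addn0 (modnMDl _ _ 8) (modn_small ha).
rewrite (divnMDl _ _ V0) (divn_small hl) addn0 (modnMDl _ l V) (modn_small hl).
rewrite (divnMDl _ _ V0) (divn_small hj) addn0 (modnMDl _ j V) (modn_small hj).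
by case: a1 {ha}; case: a2; case: a3.
Qed.

(** V is at most 5q^k and q at most 6db, so 8V^3 is at most 1000 (6d)^(3k) b^(3k), where 1000 = 8 *
    5^3; the last factor b of b^(3k+1) pays for the constant. *)
Lemma cert_size_bound k b : 0 < k -> 1000 * (6 * num_digits k) ^ (3 * k) <= b ->
  cert_size k b ^ 3 * 8 <= b ^ len_exp k.
Proof.
move=> k0 hb; set d := num_digits k in hb *.
have d0 : 0 < d by rewrite /d /num_digits addn2.
have b0 : 0 < b.
  by apply: leq_trans hb; rewrite muln_gt0 expn_gt0 muln_gt0 d0.
have hq : query_size d b <= 6 * d * b by rewrite /query_size; nia.
have hV : cert_size k b <= 5 * (6 * d * b) ^ k.
  have h1 : query_size d b <= query_size d b ^ k.
    by rewrite -{1}[query_size d b]expn1 leq_pexp2l // /query_size addn_gt0 orbT.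
  have h2 : query_size d b ^ k <= (6 * d * b) ^ k by rewrite leq_exp2r.
  have h3 : 0 < (6 * d * b) ^ k by rewrite expn_gt0; lia.
  rewrite /cert_size -/d; lia.
apply: (@leq_trans ((5 * (6 * d * b) ^ k) ^ 3 * 8)).
  by apply: leq_mul => //; rewrite leq_exp2r.
rewrite expnMn -expnM (mulnC k) expnMn /len_exp addn1 (expnS b).
rewrite [X in X <= _](_ : _ = 1000 * (6 * d) ^ (3 * k) * b ^ (3 * k)); last first.
  by move: ((6 * d) ^ _) (b ^ _) => u v; lia.
by rewrite leq_mul2r hb orbT.
Qed.

Lemma slots_bound k b s : 0 < k -> 5 <= b -> s <= (b ^ len_exp k) ^ k ->
  (b ^ len_exp k).+1 + 3 * s <= b ^ num_digits k.
Proof.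
move=> k0 b5; set n := b ^ len_exp k => hs.
have n0 : 0 < n by rewrite expn_gt0; lia.
have h1 : n <= n ^ k by rewrite -{1}[n]expn1 leq_pexp2l.
have h2 : 0 < n ^ k by rewrite expn_gt0 n0.
rewrite /num_digits expnD expnM -/n.
apply: (@leq_trans (n ^ k * 5)); first by lia.
by rewrite leq_mul2l; apply/orP; right; rewrite expnS expn1; nia.
Qed.

(** The diagonal input x is the constraint table of [D] at the query length, padded to length n.
    With it, the definition of the hard language says that [C n] rejects x. *)
Lemma co_decides_violations_contradiction k c C D b :
  0 < k -> 5 <= b -> cert_size k b ^ 3 * 8 <= b ^ len_exp k ->
  (forall x : seq bool, size x = b ^ len_exp k ->
     hard_witness_size k b <= poly_bound c (size x)) ->
  circuit_ok (b ^ len_exp k) (C (b ^ len_exp k)) ->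
  circuit_size (C (b ^ len_exp k)) <= (b ^ len_exp k) ^ k ->
  circuit_ok (query_size (num_digits k) b) (D (query_size (num_digits k) b)) ->
  circuit_size (D (query_size (num_digits k) b)) <=
    query_size (num_digits k) b ^ k ->
  co_decides C (hard_language k c) -> co_decides D (violation_language k C) ->
  False.
Proof.
move=> k0 b5 hV; set n := b ^ len_exp k in hV *; set q := query_size _ b.
move=> hw okC szC okD szD decC decD.
have b0 : 0 < b by lia.
pose V := cert_size k b; pose N := b ^ num_digits k.
pose x := violation_table (D q) q V n.
have sx : size x = n by rewrite size_mkseq.
have hN : n.+1 + 3 * circuit_size (C n) <= N by exact: slots_bound.
have hVD : q.+1 + 3 * circuit_size (D q) <= V.
  by rewrite /V /cert_size leq_add2l leq_mul2l.
have hx := hard_languageE b0 sx (hw x sx); rewrite sx in hx.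
have {}hx := hx hV.
(* A certificate exists iff [D] rejects the query, that is, iff the query is not in the violation
   language, that is, iff [C n] has no violated constraint there. *)
have certE v i j l : i < N -> j < N -> l < N ->
    (exists u, certifies k b x v i j l u) <->
    ~~ violated (C n) n i j l (v i) (v j) (v l).
  move=> hi hj hl; set y := query (num_digits k) b i j l (v i) (v j) (v l).
  have sy : size y = q by rewrite size_query.
  have <- : ~ violation_language k C y <-> ~~ violated (C n) n i j l (v i) (v j) (v l).
    split=> [h|/negP h [b' [i' [j' [l' [a1 [a2 [a3 [b'0 [hi' hj' hl'] yE hv]]]]]]]]].
      apply: contra_notN h => h.
      by exists b, i, j, l, (v i), (v j), (v l).
    (* The length 3db + 3 of a query determines b, so the query refers to the circuit for this n
       only. *)
    have bE : b' = b.
      move: (congr1 size yE); rewrite !size_query /query_size /num_digits.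
      by nia.
    rewrite bE in hi' hj' hl' yE hv.
    have [iE jE lE [e1 e2 e3]] := query_inj b0 hi hj hl hi' hj' hl' yE.
    by apply: h; rewrite e1 e2 e3 iE jE lE.
  rewrite decD sy co_acceptsN (circuit_constraints okD hVD sy).
  split=> -[u [h1 h2]]; exists u; split=> //.
    move=> i' j' l' hi' hj' hl'.
    by rewrite -(nth_violation_table (D q) q _ _ _ hV) // h2.
  move=> i' j' l' hi' hj' hl'.
  by rewrite nth_violation_table // h2.
have key : hard_language k c x <-> ~ hard_language k c x.
  rewrite {2}decC sx co_acceptsN (circuit_constraints okC hN sx) hx.
  split=> -[v [h1 h2]]; exists v; split=> // i j l hi hj hl.
    by apply/certE => //; exact: h2.
  by apply/certE => //; exact: h2.
by have [h1 h2] := key; have h hh := h1 hh hh; exact: h (h2 h).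
Qed.

Lemma hard_witness_bound k : exists c, forall b (x :
  seq bool), 0 < b -> size x = b ^ len_exp k ->
  hard_witness_size k b <= poly_bound c (size x).
Proof.
have [a ha] := pbounded_hard_witness_size k.
have [c hc] := poly_bound_pow a 0; exists c => b x b0 sx.
apply: leq_trans (ha b) _; apply: leq_trans (hc _); rewrite addn0.
have bx : b <= size x by rewrite sx /len_exp addn1 -[X in X <= _]expn1 leq_pexp2l.
by case: (posnP a) => [->|a0] //; rewrite leq_exp2r.
Qed.

Theorem theorem4p4 (k : nat) (hk : 0 < k) :
  exists L : language, NP L /\ ~ P_uniform_coNSIZE (fun n => n ^ k) L.
Proof.
have [c hc] := hard_witness_bound k.
(* If the hard language has a uniform family, that family defines the second candidate, which is
   then the language sought. *)
case: (excluded_middle_informative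
  (P_uniform_coNSIZE (fun n => n ^ k) (hard_language k c))) => [|h]; last first.
  by exists (hard_language k c); split=> //; exact: NP_hard_language.
case=> C [[okC [n0 szC] decC] [M [cM MC]]].
exists (violation_language k C); split; first exact: NP_violation_language MC.
case=> D [[okD [n1 szD] decD] _].
(* Both n and the query length are at least b, so b above [n0] and [n1] makes both asymptotic size
   bounds apply; 5 and [m] are the thresholds of [slots_bound] and [cert_size_bound]. *)
pose m := 1000 * (6 * num_digits k) ^ (3 * k); pose b := 5 + n0 + n1 + m.
have b0 : 0 < b by [].
have bn : b <= b ^ len_exp k by rewrite /len_exp addn1 -[X in X <= _]expn1 leq_pexp2l.
have [b5 bn0 bn1 bm] : [/\ 5 <= b, n0 <= b, n1 <= b & m <= b].
  by rewrite /b; move: (m) => m'; split; lia.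
apply: (@co_decides_violations_contradiction k c C D b) => //.
- exact: cert_size_bound.
- by move=> x; exact: hc.
- by apply: szC; exact: leq_trans bn.
apply: szD; rewrite /query_size.
have : b <= num_digits k * b by rewrite leq_pmull // /num_digits addn2.
by move: (num_digits k * b) => u; lia.
Qed.
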